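(* Let the macroscopic variables $n>0$, $\theta>0$, $\eta$, $p$, $\rho$ satisfy, with $z=\frac{m_0c^2}{k_B\theta}$, $$p=k_Bn\theta=m_0c^2\frac nz,\qquad \rho=3p+m_0c^2n\frac{K_1(z)}{K_2(z)},\qquad n=4\pi e^4m_0^3c^3h^{-3}\exp\Big(\frac{-\eta}{k_B}\Big)\frac{K_2(z)}{z}\exp\Big(z\frac{K_1(z)}{K_2(z)}\Big).$$ Then if $0<z\le1/10$ or $z\ge70$, $p$ can be expressed as a smooth function $f_{kinetic}$ of $\eta$ and $\rho$: $p=f_{kinetic}(\eta,\rho)$. Furthermore, for $0<z\le1/10$, $$\left|\left.\frac{\partial p}{\partial\rho}\right|_\eta-\frac13\right|\le z^2,$$ and for $z\ge70$, $$\left|\left.\frac{\partial\rho}{\partial p}\right|_\eta-\frac{3z}5\right|\le41 .$$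
   Context: $m_0,c,k_B,h>0$ are fixed constants and $e$ is Euler's number. For $j\ge0$ and $z>0$, $K_j(z)=\frac{2^jj!}{(2j)!}z^{-j}\int_z^\infty e^{-\lambda}(\lambda^2-z^2)^{j-1/2}\,d\lambda$. The relations make $\eta,p,\rho$ smooth functions of $(n,z)\in(0,\infty)^2$ (equivalently, $n,p,\rho$ are smooth functions of $(\eta,z)$). The notation $\partial_U|_V$ means partial differentiation with respect to $U$ with $V$ held constant; thus $\left.\frac{\partial p}{\partial\rho}\right|_\eta=\frac{\partial_z|_\eta\,p}{\partial_z|_\eta\,\rho}$ and $\left.\frac{\partial\rho}{\partial p}\right|_\eta=\frac{\partial_z|_\eta\,\rho}{\partial_z|_\eta\,p}$; these are functions of $z$ alone. The statement that $p$ is a function of $(\eta,\rho)$ refers to each of the two regimes $0<z\le 1/10$ and $z\ge70$. *)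

(* Defs.v *)
From Stdlib Require Import Reals Factorial.
From Coquelicot Require Import Coquelicot.
Open Scope R_scope.

(* The lower endpoint is approached from the right, as the integrand is
   singular at lambda = z when j = 0, and [Rpower 0 _] is a junk value. *)
Definition bessel_K (j : nat) (z : R) : R :=
  2 ^ j * INR (fact j) / INR (fact (2 * j)) * / z ^ j *
  RInt_gen (fun lambda : R =>
              exp (- lambda) * Rpower (lambda ^ 2 - z ^ 2) (INR j - 1 / 2))
           (at_right z) (Rbar_locally p_infty).

Definition bessel_ratio (z : R) : R := bessel_K 1 z / bessel_K 2 z.

Definition n_of (m0 c kB h eta z : R) : R :=
  4 * PI * exp 1 ^ 4 * m0 ^ 3 * c ^ 3 * / h ^ 3 * exp (- eta / kB) *
  (bessel_K 2 z / z) * exp (z * bessel_ratio z).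

Definition p_of (m0 c kB h eta z : R) : R :=
  m0 * c ^ 2 * (n_of m0 c kB h eta z / z).

Definition rho_of (m0 c kB h eta z : R) : R :=
  3 * p_of m0 c kB h eta z +
  m0 * c ^ 2 * n_of m0 c kB h eta z * bessel_ratio z.

Definition z_of (m0 c kB theta : R) : R := m0 * c ^ 2 / (kB * theta).

Definition kinetic_relations (m0 c kB h n theta eta p rho : R) : Prop :=
  let z := z_of m0 c kB theta in
  0 < n /\ 0 < theta /\
  p = kB * n * theta /\
  rho = 3 * p + m0 * c ^ 2 * n * bessel_ratio z /\
  n = n_of m0 c kB h eta z.

(* C^infinity on a set of the plane; meant for open sets. *)
Definition smooth_on (O : R * R -> Prop) (f : R -> R -> R) : Prop :=
  forall (k : nat) (x y : R), O (x, y) -> ex_diff_n f k x y.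

(* The set of values (eta, rho) of a closed regime such as z <= 1/10 is not
   open, so f is required to be smooth on an open neighbourhood O of it. *)
Definition p_smooth_function_of_eta_rho
    (m0 c kB h : R) (regime : R -> Prop) : Prop :=
  exists (O : R * R -> Prop) (f_kinetic : R -> R -> R),
    open O /\ smooth_on O f_kinetic /\
    forall n theta eta p rho : R,
      kinetic_relations m0 c kB h n theta eta p rho ->
      regime (z_of m0 c kB theta) ->
      O (eta, rho) /\ p = f_kinetic eta rho.

(* [Derive] and [/] are total, so the existence of a partial derivative at
   constant eta is stated separately: U and V, as functions of (eta, z), have
   z-derivatives and that of V does not vanish. *)
Definition ex_partial_at_eta (U V : R -> R -> R) (eta z : R) : Prop :=
  ex_derive (U eta) z /\ ex_derive (V eta) z /\ Derive (V eta) z <> 0.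

(* dU/dV at constant eta, at the point (eta, z) *)
Definition partial_at_eta (U V : R -> R -> R) (eta z : R) : R :=
  Derive (U eta) z / Derive (V eta) z.

(* Main.v *)
Require Import Defs.
From Stdlib Require Import Reals Lra Psatz ClassicalEpsilon.
From Coquelicot Require Import Coquelicot.
Open Scope R_scope.

(* After the substitution lambda = z s, K_1 and K_2 are Laplace transforms of
   powers of s ^ 2 - 1; differentiating under the integral and integrating by
   parts give K_1' = K_1 / z - K_2 and K_2' = - K_1 - 2 K_2 / z.  With r = K_1 / K_2
   and t = z r, logarithmic differentiation at constant eta yields
     z p' / p = D := t ^ 2 + 3 t - z ^ 2 - 4  and
     z rho' / p = D (3 + t) + (t ^ 2 + 4 t - z ^ 2),
   so both estimates reduce to bounds on r.  For small z, 0 < r <= z / 2 suffices.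
   For large z, r solves the Riccati equation r' = r ^ 2 + 3 r / z - 1, and sub- and
   supersolutions of the form 1 - 3 / (2 z) + 15 / (8 z ^ 2) - d / z ^ 3 enclose r
   because K_1 - R K_2, times an integrating factor, is monotone and tends to 0.
   The same estimates, on slightly larger open intervals of z, show that rho is
   strictly monotone in z at constant eta; the smooth p(eta, rho) is obtained by
   inverting z |-> rho exp (eta / k_B), and C^infinity holds because expressions
   in z, K_1, K_2 are closed under differentiation. *)

(** * Laplace transforms *)

(** Boundedness against every positive rate, rather than a polynomial bound, is easily stable under
    multiplication by [s]. Continuity on the whole line makes [exp (- z * s) * g s] integrable on
    every compact interval without side conditions. *)
Definition subexponential (g : R -> R) : Prop :=
  (forall s, continuous g s) /\
  forall z, 0 < z -> exists C, forall s, 1 <= s -> Rabs (g s) * exp (- z * s) <= C.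

Definition truncated_laplace (g : R -> R) (z x : R) : R :=
  RInt (fun s => exp (- z * s) * g s) 1 x.

(** The integral starts at 1, the image of the endpoint lambda = z under lambda = z s. [Lim] is
    total; [is_lim_laplace] shows that the limit is genuine and finite for subexponential [g] and
    positive [z]. *)
Definition laplace (g : R -> R) (z : R) : R :=
  real (Lim (truncated_laplace g z) p_infty).

Lemma continuous_laplace_integrand (g : R -> R) (z s : R) :
  continuous g s -> continuous (fun s => exp (- z * s) * g s) s.
Proof.
intros Hg.
apply (continuous_mult (fun s => exp (- z * s)) g); auto.
apply (ex_derive_continuous (fun s => exp (- z * s))). auto_derive. exact I.
Qed.

Lemma ex_RInt_laplace_integrand (g : R -> R) (z a b : R) :
  (forall s, continuous g s) -> ex_RInt (fun s => exp (- z * s) * g s) a b.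
Proof.
intros Hg. apply (ex_RInt_continuous (V := R_CompleteNormedModule)).
intros s _. now apply continuous_laplace_integrand.
Qed.

Lemma is_derive_truncated_laplace (g : R -> R) (z x : R) :
  (forall s, continuous g s) ->
  is_derive (truncated_laplace g z) x (exp (- z * x) * g x).
Proof.
intros Hg.
apply (is_derive_RInt (fun s => exp (- z * s) * g s) _ 1 x).
- exists (mkposreal 1 Rlt_0_1). intros y _.
  apply (RInt_correct (V := R_CompleteNormedModule)).
  now apply ex_RInt_laplace_integrand.
- now apply continuous_laplace_integrand.
Qed.

Lemma subexponential_plus (f g : R -> R) :
  subexponential f -> subexponential g -> subexponential (fun s => f s + g s).
Proof.
intros [cf Hf] [cg Hg]; split.
- intros s. now apply (continuous_plus f g).
- intros z hz. destruct (Hf z hz) as [C HC], (Hg z hz) as [D HD].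
  exists (C + D). intros s hs. specialize (HC s hs). specialize (HD s hs).
  pose proof (Rabs_triang (f s) (g s)). pose proof (exp_pos (- z * s)). nra.
Qed.

Lemma subexponential_scal (c : R) (g : R -> R) :
  subexponential g -> subexponential (fun s => c * g s).
Proof.
intros [cg Hg]; split.
- intros s. now apply (continuous_scal_r c g).
- intros z hz. destruct (Hg z hz) as [D HD].
  exists (Rabs c * D). intros s hs. specialize (HD s hs).
  rewrite Rabs_mult, Rmult_assoc.
  apply Rmult_le_compat_l; auto. apply Rabs_pos.
Qed.

Lemma subexponential_const (c : R) : subexponential (fun _ => c).
Proof.
split.
- intros s. apply continuous_const.
- intros z hz. exists (Rabs c). intros s hs.
  rewrite <- (Rmult_1_r (Rabs c)) at 2.
  apply Rmult_le_compat_l; [apply Rabs_pos|].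
  rewrite <- exp_0. left; apply exp_increasing; nra.
Qed.

(** The weight exp (- z s) splits into two factors of rate z / 2: one absorbs [s], because u exp (-
    u) <= 1, and the other controls [g]. *)
Lemma subexponential_mult_id (g : R -> R) :
  subexponential g -> subexponential (fun s => s * g s).
Proof.
intros [cg Hg]; split.
- intros s. apply (continuous_mult (fun s => s) g); auto. apply continuous_id.
- intros z hz. destruct (Hg (z / 2) ltac:(lra)) as [D HD].
  exists (2 / z * D). intros s hs. specialize (HD s hs).
  rewrite Rabs_mult, (Rabs_pos_eq s) by lra.
  replace (- z * s) with (- (z / 2) * s + - (z / 2) * s) by field.
  rewrite exp_plus.
  assert (H : s * exp (- (z / 2) * s) <= 2 / z).
  { replace (- (z / 2) * s) with (- (z / 2 * s)) by ring.
    pose proof (exp_ineq1_le (z / 2 * s)).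
    pose proof (exp_pos (- (z / 2 * s))).
    assert (He : exp (z / 2 * s) * exp (- (z / 2 * s)) = 1)
      by (rewrite <- exp_plus, Rplus_opp_r; apply exp_0).
    assert (0 < 2 / z) by (apply Rdiv_lt_0_compat; lra).
    replace (s * exp (- (z / 2 * s)))
      with (2 / z * (z / 2 * s * exp (- (z / 2 * s)))) by (field; lra).
    rewrite <- (Rmult_1_r (2 / z)) at 2.
    apply Rmult_le_compat_l; [lra|]. nra. }
  pose proof (exp_pos (- (z / 2) * s)). pose proof (Rabs_pos (g s)).
  replace (s * Rabs (g s) * (exp (- (z / 2) * s) * exp (- (z / 2) * s)))
    with ((s * exp (- (z / 2) * s)) * (Rabs (g s) * exp (- (z / 2) * s))) by ring.
  apply Rmult_le_compat; auto; nra.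
Qed.

Lemma subexponential_id : subexponential (fun s => s).
Proof.
destruct (subexponential_mult_id _ (subexponential_const 1)) as [H1 H2].
split.
- intros s. apply continuous_id.
- intros z hz. destruct (H2 z hz) as [C HC]. exists C. intros s hs.
  specialize (HC s hs). rewrite Rmult_1_r in HC. exact HC.
Qed.

Lemma subexponential_le (f g : R -> R) :
  (forall s, continuous f s) -> subexponential g ->
  (forall s, 1 <= s -> Rabs (f s) <= g s) -> subexponential f.
Proof.
intros cf [_ Hg] Hfg; split; auto.
intros z hz. destruct (Hg z hz) as [C HC]. exists C. intros s hs.
apply Rle_trans with (2 := HC s hs).
apply Rmult_le_compat_r; [apply Rlt_le, exp_pos|].
apply Rle_trans with (1 := Hfg s hs), Rle_abs.
Qed.

(** Since s ^ 2 g is again subexponential, s ^ 2 exp (- z s) g is bounded. The integrable majorant C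
    / s ^ 2 gives convergence of the transform and kills boundary terms at infinity. *)
Lemma subexponential_decay (g : R -> R) (z : R) :
  subexponential g -> 0 < z ->
  exists C, 0 < C /\ forall s, 1 <= s -> Rabs (exp (- z * s) * g s) <= C / s ^ 2.
Proof.
intros Hg hz.
destruct (subexponential_mult_id _ (subexponential_mult_id _ Hg)) as [_ H].
destruct (H z hz) as [C HC]. exists (Rmax 1 C). split.
- apply Rlt_le_trans with 1; [lra|apply Rmax_l].
- intros s hs. apply Rle_div_r; [nra|].
  apply Rle_trans with C; [|apply Rmax_r].
  apply Rle_trans with (2 := HC s hs).
  rewrite !Rabs_mult, (Rabs_pos_eq s), (Rabs_pos_eq (exp _)) by (try lra; apply Rlt_le, exp_pos).
  right; ring.
Qed.

(** Cauchy criterion: the majorant C / s ^ 2 has primitive - C / s, so the integral from x to y is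
    at most C / x in absolute value, which is below eps once x exceeds C / eps. *)
Lemma is_lim_laplace (g : R -> R) (z : R) :
  subexponential g -> 0 < z ->
  is_lim (truncated_laplace g z) p_infty (laplace g z).
Proof.
intros Hg hz. apply Lim_correct'.
destruct (subexponential_decay g z Hg hz) as [C [hC HC]].
destruct Hg as [cg _].
assert (Hxy : forall x y, 1 <= x <= y ->
  Rabs (truncated_laplace g z y - truncated_laplace g z x) <= C / x).
{ intros x y hxy.
  assert (HI : is_RInt (fun s => C / s ^ 2) x y (minus (- C / y) (- C / x))).
  { apply (is_RInt_derive (fun s => - C / s) (fun s => C / s ^ 2)).
    - intros s hs. rewrite Rmin_left, Rmax_right in hs by lra.
      auto_derive; [lra|field; lra].
    - intros s hs. rewrite Rmin_left, Rmax_right in hs by lra.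
      apply (ex_derive_continuous (fun s => C / s ^ 2)).
      auto_derive. assert (0 < s) by lra. nra. }
  pose proof (ex_RInt_laplace_integrand g z x y cg) as He.
  replace (truncated_laplace g z y - truncated_laplace g z x)
    with (RInt (fun s => exp (- z * s) * g s) x y).
  - apply Rle_trans with (minus (- C / y) (- C / x)).
    + apply (norm_RInt_le (V := R_NormedModule) (fun s => exp (- z * s) * g s) (fun s => C / s ^ 2) x y); try tauto.
      * intros s hs. apply HC. lra.
      * apply (RInt_correct (V := R_CompleteNormedModule)), He.
    + unfold minus, plus, opp; simpl.
      assert (0 < C / y) by (apply Rdiv_lt_0_compat; lra).
      replace (- C / y) with (- (C / y)) by (field; lra).
      replace (- C / x) with (- (C / x)) by (field; lra). lra.
  - set (f := fun s => exp (- z * s) * g s) in *.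
    assert (HCh : RInt f 1 x + RInt f x y = RInt f 1 y).
    { apply (RInt_Chasles (V := R_CompleteNormedModule) f 1 x y);
        now apply ex_RInt_laplace_integrand. }
    unfold truncated_laplace. fold f. lra. }
destruct (proj1 (filterlim_locally_cauchy (F := Rbar_locally' p_infty)
  (truncated_laplace g z))) as [l Hl].
- intros eps. exists (fun x => Rmax 1 (C / eps) < x). split.
  + exists (Rmax 1 (C / eps)). auto.
  + assert (Hd : forall u v, Rmax 1 (C / eps) < u -> u <= v ->
      Rabs (truncated_laplace g z v - truncated_laplace g z u) < eps).
    { intros u v hu huv.
      pose proof (Rmax_l 1 (C / eps)). pose proof (Rmax_r 1 (C / eps)).
      pose proof (cond_pos eps).
      apply Rle_lt_trans with (C / u). { apply Hxy. lra. }
      apply Rlt_div_l; [lra|]. rewrite Rmult_comm. apply Rlt_div_l; lra. }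
    intros u v hu hv. unfold ball; simpl; unfold AbsRing_ball, abs, minus, plus, opp; simpl.
    destruct (Rle_dec u v).
    * apply (Hd u v); auto.
    * rewrite <- Rabs_Ropp, Ropp_plus_distr, Ropp_involutive, Rplus_comm.
      apply (Hd v u); auto; lra.
- exists l. exact Hl.
Qed.

(** Inequalities between transforms are proved below by applying this to truncated integrals as
    functions of their upper endpoint, then letting that endpoint tend to infinity. *)
Lemma nonneg_of_derive_nonneg (f df : R -> R) (a : R) :
  (forall x, a <= x -> is_derive f x (df x)) ->
  (forall x, a <= x -> 0 <= df x) -> f a = 0 ->
  forall x, a <= x -> 0 <= f x.
Proof.
intros Hf Hdf Ha x hx.
destruct (MVT_gen f a x df) as [c [Hc E]].
- intros y hy. rewrite Rmin_left in hy by lra. apply Hf. lra.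
- intros y hy. rewrite Rmin_left in hy by lra.
  apply continuity_pt_filterlim. apply (ex_derive_continuous f).
  exists (df y). apply Hf. lra.
- rewrite Rmin_left in Hc by lra. specialize (Hdf c ltac:(lra)). nra.
Qed.

Lemma is_lim_nonneg (f : R -> R) (a l : R) :
  (forall x, a <= x -> 0 <= f x) -> is_lim f p_infty l -> 0 <= l.
Proof.
intros Hf Hl.
apply (is_lim_le_loc (fun _ => 0) f p_infty 0 l); auto.
- exists a. intros x hx. apply Hf. lra.
- apply is_lim_const.
Qed.

Lemma truncated_laplace_1 (g : R -> R) (z : R) : truncated_laplace g z 1 = 0.
Proof. apply (RInt_point (V := R_CompleteNormedModule)). Qed.

Lemma laplace_plus (f g : R -> R) (z : R) :
  subexponential f -> subexponential g -> 0 < z ->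
  laplace (fun s => f s + g s) z = laplace f z + laplace g z.
Proof.
intros Hf Hg hz.
assert (E : Lim (truncated_laplace (fun s => f s + g s) z) p_infty
  = Finite (laplace f z + laplace g z)).
{ apply is_lim_unique.
  apply is_lim_ext with (fun x => truncated_laplace f z x + truncated_laplace g z x).
  - intros x. unfold truncated_laplace.
    rewrite (RInt_ext (V := R_CompleteNormedModule) (fun s => exp (- z * s) * (f s + g s))
      (fun s => plus (exp (- z * s) * f s) (exp (- z * s) * g s)))
      by (intros; unfold plus; simpl; ring).
    symmetry.
    apply (RInt_plus (V := R_CompleteNormedModule));
      apply ex_RInt_laplace_integrand; apply Hf || apply Hg.
  - apply is_lim_plus'; now apply is_lim_laplace. }
unfold laplace at 1. now rewrite E.
Qed.

Lemma laplace_scal (c : R) (g : R -> R) (z : R) :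
  subexponential g -> 0 < z -> laplace (fun s => c * g s) z = c * laplace g z.
Proof.
intros Hg hz.
assert (E : Lim (truncated_laplace (fun s => c * g s) z) p_infty
  = Finite (c * laplace g z)).
{ apply is_lim_unique.
  apply is_lim_ext with (fun x => c * truncated_laplace g z x).
  - intros x. unfold truncated_laplace.
    rewrite (RInt_ext (V := R_CompleteNormedModule) (fun s => exp (- z * s) * (c * g s))
      (fun s => scal c (exp (- z * s) * g s)))
      by (intros; unfold scal; simpl; unfold mult; simpl; ring).
    symmetry.
    apply (RInt_scal (V := R_CompleteNormedModule)).
    apply ex_RInt_laplace_integrand; apply Hg.
  - apply (is_lim_scal_l (truncated_laplace g z) c p_infty (laplace g z)).
    now apply is_lim_laplace. }
unfold laplace at 1. now rewrite E.
Qed.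

Lemma laplace_le (f g : R -> R) (z : R) :
  subexponential f -> subexponential g -> 0 < z ->
  (forall s, 1 <= s -> f s <= g s) -> laplace f z <= laplace g z.
Proof.
intros Hf Hg hz Hfg. apply Rminus_le_0.
apply (is_lim_nonneg (fun x => truncated_laplace g z x - truncated_laplace f z x) 1).
- apply (nonneg_of_derive_nonneg _
    (fun x => minus (exp (- z * x) * g x) (exp (- z * x) * f x))).
  + intros x hx. apply (is_derive_minus (truncated_laplace g z) (truncated_laplace f z));
      apply is_derive_truncated_laplace; apply Hf || apply Hg.
  + intros x hx. unfold minus, plus, opp; simpl.
    specialize (Hfg x hx). pose proof (exp_pos (- z * x)). nra.
  + rewrite !truncated_laplace_1. ring.
- apply is_lim_minus'; now apply is_lim_laplace.
Qed.

(** The interval from 1 to 2 contributes a strictly positive amount and the rest is nonnegative.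
    Positivity is asked only for s > 1 because the Bessel weights vanish at 1. *)
Lemma laplace_pos (g : R -> R) (z : R) :
  subexponential g -> 0 < z -> (forall s, 1 < s -> 0 < g s) -> 0 < laplace g z.
Proof.
intros Hg hz Hpos.
assert (H2 : 0 < truncated_laplace g z 2).
{ apply RInt_gt_0; [lra| |].
  - intros x hx. apply Rmult_lt_0_compat; [apply exp_pos|apply Hpos; lra].
  - intros x hx. apply continuous_laplace_integrand, Hg. }
apply Rlt_le_trans with (1 := H2). apply Rminus_le_0.
apply (is_lim_nonneg (fun x => truncated_laplace g z x - truncated_laplace g z 2) 2).
- apply (nonneg_of_derive_nonneg _ (fun x => minus (exp (- z * x) * g x) 0)).
  + intros x hx. apply (is_derive_minus (truncated_laplace g z) (fun _ => truncated_laplace g z 2)).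
    * apply is_derive_truncated_laplace, Hg.
    * apply (is_derive_const (truncated_laplace g z 2)).
  + intros x hx. unfold minus, plus, opp; simpl.
    specialize (Hpos x ltac:(lra)). pose proof (exp_pos (- z * x)). nra.
  + ring.
- apply is_lim_minus'; [now apply is_lim_laplace|apply is_lim_const].
Qed.

(** The truncated identity, boundary term at x included, is the vanishing of [D]: its derivative is
    0 and [D 1 = 0] thanks to [g 1 = 0]. The boundary term then tends to 0 by
    [subexponential_decay]. *)
Lemma laplace_by_parts (g dg : R -> R) (z : R) :
  (forall s, is_derive g s (dg s)) -> subexponential g -> subexponential dg ->
  g 1 = 0 -> 0 < z -> z * laplace g z = laplace dg z.
Proof.
intros Hd Hg Hdg H1 hz.
set (D := fun x => truncated_laplace dg z x - z * truncated_laplace g z x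
                   - exp (- z * x) * g x).
assert (HD : forall x, is_derive D x 0).
{ intros x. unfold D.
  evar_last.
  apply (is_derive_minus (fun x => truncated_laplace dg z x - z * truncated_laplace g z x)
    (fun x => exp (- z * x) * g x)).
  apply (is_derive_minus (truncated_laplace dg z) (fun x => z * truncated_laplace g z x)).
  apply is_derive_truncated_laplace, Hdg.
  apply (is_derive_scal (truncated_laplace g z)).
  apply is_derive_truncated_laplace, Hg.
  apply (is_derive_mult (fun x => exp (- z * x)) g).
  - instantiate (1 := - z * exp (- z * x)). auto_derive; [exact I|ring].
  - apply Hd.
  - intros; apply Rmult_comm.
  - unfold minus, plus, opp, scal, mult; simpl; unfold mult; simpl. ring. }
assert (HD0 : forall x, 1 <= x -> D x = 0).
{ assert (D1 : D 1 = 0).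
  { unfold D. rewrite !truncated_laplace_1, H1. ring. }
  intros x hx. apply Rle_antisym.
  - apply Ropp_le_cancel. rewrite Ropp_0.
    apply (nonneg_of_derive_nonneg (fun x => - D x) (fun _ => opp 0) 1); auto.
    + intros y _. apply (is_derive_opp D). apply HD.
    + intros; unfold opp; simpl; lra.
    + rewrite D1. ring.
  - apply (nonneg_of_derive_nonneg D (fun _ => 0) 1); auto. intros; lra. }
destruct (subexponential_decay g z Hg hz) as [C [hC HC]].
assert (HB : is_lim (fun x => exp (- z * x) * g x) p_infty 0).
{ apply (is_lim_le_le_loc (fun x => - (C * / x)) (fun x => C * / x)).
  - exists 1. intros x hx. apply Rabs_le_between.
    apply Rle_trans with (1 := HC x ltac:(lra)).
    apply Rmult_le_compat_l; [lra|].
    apply Rinv_le_contravar; nra.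
  - replace (Finite 0) with (Rbar_opp (Rbar_mult C (Rbar_inv p_infty))) by (simpl; f_equal; ring).
    apply is_lim_opp. apply (is_lim_scal_l Rinv).
    apply (is_lim_inv (fun x => x)); [apply is_lim_id|discriminate].
  - replace (Finite 0) with ((Rbar_mult C (Rbar_inv p_infty))) by (simpl; f_equal; ring).
    apply (is_lim_scal_l Rinv).
    apply (is_lim_inv (fun x => x)); [apply is_lim_id|discriminate]. }
assert (HL : is_lim D p_infty (laplace dg z - z * laplace g z - 0)).
{ apply is_lim_minus'; auto. apply is_lim_minus'.
  - now apply is_lim_laplace.
  - apply (is_lim_scal_l (truncated_laplace g z) z p_infty (laplace g z)).
    now apply is_lim_laplace. }
assert (HL0 : is_lim D p_infty 0).
{ apply is_lim_ext_loc with (fun _ => 0).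
  - exists 1. intros x hx. symmetry. apply HD0. lra.
  - apply is_lim_const. }
apply is_lim_unique in HL. apply is_lim_unique in HL0.
rewrite HL in HL0. injection HL0. lra.
Qed.

(** * Differentiation under the integral sign *)

Lemma exp_taylor1 (u : R) : 0 <= exp u - 1 - u <= u ^ 2 * exp (Rabs u).
Proof.
pose proof (exp_ineq1_le u). pose proof (exp_ineq1_le (- u)).
assert (E : exp u * exp (- u) = 1) by (rewrite <- exp_plus, Rplus_opp_r; apply exp_0).
pose proof (exp_pos u).
(* This is 1 - u <= exp (- u) multiplied by exp u. It bounds the remainder exp u - 1 - u by u (exp u
   - 1), and both signs of u follow from there. *)
assert (exp u - 1 <= u * exp u) by nra.
split; [lra|].
destruct (Rle_dec 0 u).
- rewrite Rabs_pos_eq by auto. nra.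
- rewrite Rabs_left by lra. nra.
Qed.

Lemma is_derive_of_quadratic_bound (f : R -> R) (z l d C : R) :
  0 < d -> (forall h, Rabs h <= d -> Rabs (f (z + h) - f z - h * l) <= C * h ^ 2) ->
  is_derive f z l.
Proof.
intros hd H. apply is_derive_Reals. intros eps heps.
assert (hC : 0 < Rabs C + 1) by (pose proof (Rabs_pos C); lra).
assert (hm : 0 < Rmin d (eps / (Rabs C + 1))).
{ apply Rmin_pos; auto. apply Rdiv_lt_0_compat; lra. }
exists (mkposreal _ hm). simpl. intros h hh0 hh.
pose proof (Rmin_l d (eps / (Rabs C + 1))).
pose proof (Rmin_r d (eps / (Rabs C + 1))).
specialize (H h ltac:(lra)).
assert (hp : 0 < Rabs h) by now apply Rabs_pos_lt.
replace ((f (z + h) - f z) / h - l) with ((f (z + h) - f z - h * l) / h) by (field; auto).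
unfold Rdiv at 1. rewrite Rabs_mult, Rabs_inv. apply Rlt_div_l; auto.
apply Rle_lt_trans with (1 := H).
rewrite <- (pow2_abs h).
assert (Rabs h * (Rabs C + 1) < eps).
{ apply Rlt_div_r; lra. }
pose proof (Rle_abs C). nra.
Qed.

(** No dominated convergence is used. For |h| <= z / 2, [exp_taylor1] places the first-order
    remainder of the integrand between 0 and h ^ 2 s ^ 2 exp (- (z / 2) s) g, so the remainder of
    the transform lies between 0 and h ^ 2 times a constant. Nonnegativity of [g] gives the
    remainder its sign. *)
Lemma is_derive_laplace (g : R -> R) (z : R) :
  subexponential g -> (forall s, 1 <= s -> 0 <= g s) -> 0 < z ->
  is_derive (laplace g) z (- laplace (fun s => s * g s) z).
Proof.
intros Hg Hpos hz.
pose proof (subexponential_mult_id _ Hg) as Hg1.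
pose proof (subexponential_mult_id _ Hg1) as Hg2.
apply (is_derive_of_quadratic_bound _ _ _ (z / 2) (laplace (fun s => s * (s * g s)) (z / 2)));
  [lra|].
intros h hh. apply Rabs_le_between in hh.
set (D := fun x => truncated_laplace g (z + h) x - truncated_laplace g z x
                   - (- h) * truncated_laplace (fun s => s * g s) z x).
set (d := fun x => minus (minus (exp (- (z + h) * x) * g x) (exp (- z * x) * g x))
                   ((- h) * (exp (- z * x) * (x * g x)))).
assert (HD : forall x, is_derive D x (d x)).
{ intros x. unfold D, d.
  apply (is_derive_minus (fun x => truncated_laplace g (z + h) x - truncated_laplace g z x)
    (fun x => - h * truncated_laplace (fun s => s * g s) z x)).
  - apply (is_derive_minus (truncated_laplace g (z + h)) (truncated_laplace g z));
    apply is_derive_truncated_laplace, Hg.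
  - apply (is_derive_scal (truncated_laplace (fun s => s * g s) z)).
    apply (is_derive_truncated_laplace (fun s => s * g s)), Hg1. }
assert (Hd : forall x, 1 <= x -> 0 <= d x <= h ^ 2 * (exp (- (z / 2) * x) * (x * (x * g x)))).
{ intros x hx. unfold d, minus, plus, opp; simpl.
  specialize (Hpos x hx).
  replace (- (z + h) * x) with (- z * x + - (h * x)) by ring. rewrite exp_plus.
  pose proof (exp_taylor1 (- (h * x))) as [T1 T2].
  assert (T3 : exp (- z * x) * exp (Rabs (- (h * x))) <= exp (- (z / 2) * x)).
  { rewrite <- exp_plus.
    assert (- z * x + Rabs (- (h * x)) <= - (z / 2) * x).
    { rewrite Rabs_Ropp.
      assert (Rabs (h * x) <= z / 2 * x) by (apply Rabs_le_between; nra). lra. }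
    destruct H as [H|H]; [left; now apply exp_increasing|rewrite H; apply Rle_refl]. }
  pose proof (exp_pos (- z * x)).
  replace (exp (- z * x) * exp (- (h * x)) * g x + - (exp (- z * x) * g x) +
     - (- h * (exp (- z * x) * (x * g x)))) with
   (exp (- z * x) * g x * (exp (- (h * x)) - 1 - - (h * x))) by ring.
  split.
  - apply Rmult_le_pos; [nra|exact T1].
  - apply Rle_trans with (exp (- z * x) * g x * ((- (h * x)) ^ 2 * exp (Rabs (- (h * x))))).
    + apply Rmult_le_compat_l; [nra|exact T2].
    + replace (exp (- z * x) * g x * ((- (h * x)) ^ 2 * exp (Rabs (- (h * x)))))
        with ((h * x) ^ 2 * g x * (exp (- z * x) * exp (Rabs (- (h * x))))) by ring.
      replace (h * (h * 1) * (exp (- (z / 2) * x) * (x * (x * g x))))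
        with ((h * x) ^ 2 * g x * exp (- (z / 2) * x)) by ring.
      apply Rmult_le_compat_l; auto. apply Rmult_le_pos; auto. apply pow2_ge_0. }
assert (D1 : D 1 = 0) by (unfold D; rewrite !truncated_laplace_1; ring).
assert (HL : is_lim D p_infty (laplace g (z + h) - laplace g z
   - - h * laplace (fun s => s * g s) z)).
{ unfold D. apply is_lim_minus'.
  - apply is_lim_minus'; apply is_lim_laplace; auto; lra.
  - apply (is_lim_scal_l (truncated_laplace (fun s => s * g s) z) (- h) p_infty
      (laplace (fun s => s * g s) z)).
    now apply is_lim_laplace. }
set (L := laplace (fun s => s * (s * g s)) (z / 2)).
assert (HL2 : is_lim (fun x => h ^ 2 * truncated_laplace (fun s => s * (s * g s)) (z / 2) x - D x)
  p_infty (h ^ 2 * L - (laplace g (z + h) - laplace g z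
   - - h * laplace (fun s => s * g s) z))).
{ apply is_lim_minus'; auto.
  apply (is_lim_scal_l (truncated_laplace (fun s => s * (s * g s)) (z / 2)) (h ^ 2) p_infty L).
  apply is_lim_laplace; auto; lra. }
apply is_lim_nonneg with (a := 1) in HL.
apply is_lim_nonneg with (a := 1) in HL2.
- rewrite Rabs_pos_eq; lra.
- apply (nonneg_of_derive_nonneg _ (fun x =>
    minus (h ^ 2 * (exp (- (z / 2) * x) * (x * (x * g x)))) (d x))).
  + intros x _.
    apply (is_derive_minus (fun x => h ^ 2 * truncated_laplace (fun s => s * (s * g s)) (z / 2) x) D); auto.
    apply (is_derive_scal (truncated_laplace (fun s => s * (s * g s)) (z / 2))).
    apply (is_derive_truncated_laplace (fun s => s * (s * g s))), Hg2.
  + intros x hx. specialize (Hd x hx). unfold minus, plus, opp; simpl in *. lra.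
  + rewrite truncated_laplace_1, D1. ring.
- apply (nonneg_of_derive_nonneg D d); auto. intros x hx. apply Hd, hx.
Qed.

(** * Bessel functions as Laplace transforms *)

(** Substitution x = z s. The function [F] is an antiderivative, on the whole line, of a continuous
    function that agrees with [f] beyond z; the values of [f] at z and below never enter. The
    integral is the limit of [F] at infinity minus its limit at z, which is [F z = 0]. *)
Lemma RInt_gen_laplace (f g : R -> R) (c z : R) :
  subexponential g -> 0 < z ->
  (forall x, z < x -> f x = c / z * (exp (- x) * g (x / z))) ->
  RInt_gen f (at_right z) (Rbar_locally p_infty) = c * laplace g z.
Proof.
intros Hg hz Hf.
set (F := fun x => c * truncated_laplace g z (x / z)).
set (dF := fun x => c / z * (exp (- x) * g (x / z))).
assert (HF : forall x, is_derive F x (dF x)).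
{ intros x. unfold F, dF.
  replace (c / z * (exp (- x) * g (x / z)))
    with (c * (/ z * (exp (- z * (x / z)) * g (x / z)))).
  - apply (is_derive_scal (fun x => truncated_laplace g z (x / z))).
    apply (is_derive_comp (truncated_laplace g z) (fun x => x / z)).
    + apply is_derive_truncated_laplace, Hg.
    + auto_derive; [exact I|]. unfold Rdiv. ring.
  - replace (- z * (x / z)) with (- x) by (field; lra). field. lra. }
assert (HcdF : forall x, continuous dF x).
{ intros x. unfold dF.
  apply (continuous_scal_r (c / z) (fun x => exp (- x) * g (x / z))).
  apply (continuous_mult (fun x => exp (- x)) (fun x => g (x / z))).
  - apply (ex_derive_continuous (fun x => exp (- x))). auto_derive. exact I.
  - apply (continuous_comp (fun x => x / z) g).
    + apply (ex_derive_continuous (fun x => x / z)). auto_derive. exact I.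
    + apply Hg. }
apply (is_RInt_gen_unique (V := R_CompleteNormedModule)).
apply is_RInt_gen_ext with (Derive F).
- exists (fun a => z < a) (fun b => z < b).
  + exists (mkposreal 1 Rlt_0_1). auto.
  + exists z. auto.
  + intros a b ha hb x [hx _]. simpl in hx.
    rewrite (is_derive_unique _ _ _ (HF x)). symmetry. apply Hf.
    apply Rlt_trans with (2 := hx). now apply Rmin_glb_lt.
- replace (c * laplace g z) with (c * laplace g z - 0) by ring.
  apply is_RInt_gen_Derive.
  + apply filter_forall. intros ab x _. exists (dF x). apply HF.
  + apply filter_forall. intros ab x _.
    apply continuous_ext with dF; auto.
    intros y. symmetry. apply is_derive_unique, HF.
  + replace 0 with (F z).
    * apply (filterlim_filter_le_1 (F := locally z)).
      { apply filter_le_within. }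
      apply (ex_derive_continuous F). exists (dF z). apply HF.
    * unfold F. replace (z / z) with 1 by (field; lra).
      rewrite truncated_laplace_1. ring.
  + change (is_lim F p_infty (Rbar_mult c (laplace g z))).
    apply is_lim_scal_l.
    apply (is_lim_comp (truncated_laplace g z) (fun x => x / z) p_infty (laplace g z) p_infty).
    * now apply is_lim_laplace.
    * apply is_lim_ext with (fun x => / z * x); [intros; unfold Rdiv; ring|].
      evar_last. apply (is_lim_scal_l (fun x => x)), is_lim_id.
      simpl. case Rle_dec.
      -- intros h. case Rle_lt_or_eq_dec; auto. intros e.
         pose proof (Rinv_0_lt_compat z hz). lra.
      -- pose proof (Rinv_0_lt_compat z hz). lra.
    * exists 0. discriminate.
Qed.

(** Up to powers of z and constants, K_1 and K_2 are the transforms of s ^ 2 - 1 raised to 1/2 and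
    3/2. With [sqrt], which is 0 on negative reals, both weights are continuous on the whole line,
    as [subexponential] demands. *)
Definition root_weight (s : R) : R := sqrt (s ^ 2 - 1).
Definition cubic_weight (s : R) : R := (s ^ 2 - 1) * root_weight s.

Lemma root_weight_bounds (s : R) : 1 <= s -> 0 <= root_weight s <= s.
Proof.
intros hs. split; [apply sqrt_pos|].
unfold root_weight. rewrite <- (sqrt_pow2 s) at 2 by lra.
apply sqrt_le_1_alt. lra.
Qed.

Lemma root_weight_sqr (s : R) : 1 <= s -> root_weight s * root_weight s = s ^ 2 - 1.
Proof. intros hs. apply sqrt_sqrt. nra. Qed.

Lemma root_weight_pos (s : R) : 1 < s -> 0 < root_weight s.
Proof. intros hs. apply sqrt_lt_R0. nra. Qed.

Lemma continuous_root_weight (s : R) : continuous root_weight s.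
Proof.
apply (continuous_comp (fun s => s ^ 2 - 1) sqrt).
- apply (ex_derive_continuous (fun s => s ^ 2 - 1)). auto_derive. exact I.
- apply continuous_sqrt.
Qed.

Lemma subexponential_root_weight : subexponential root_weight.
Proof.
apply subexponential_le with (fun s => s).
- apply continuous_root_weight.
- apply subexponential_id.
- intros s hs. pose proof (root_weight_bounds s hs). rewrite Rabs_pos_eq; lra.
Qed.

(* [sqrt] vanishes on negative reals, so the formula also holds for [x <= 0]. *)
Lemma is_derive_mult_sqrt (x : R) : is_derive (fun x => x * sqrt x) x (3 / 2 * sqrt x).
Proof.
destruct (Rtotal_order x 0) as [hx | [hx | hx]].
- rewrite sqrt_neg_0 by lra.
  apply (is_derive_ext_loc (fun _ => 0)).
  + exists (mkposreal (- x) ltac:(lra)). simpl. intros y hy.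
    apply Rabs_lt_between' in hy. rewrite sqrt_neg_0; lra.
  + evar_last. apply (is_derive_const 0). unfold zero; simpl. ring.
- subst x. rewrite sqrt_0, Rmult_0_r. apply is_derive_Reals.
  (* At 0 the difference quotient is sqrt h, which is below eps as soon as |h| < eps ^ 2. *)
  intros eps heps. exists (mkposreal (eps ^ 2) ltac:(nra)). simpl.
  intros h hh hlt. rewrite Rplus_0_l, sqrt_0.
  replace ((h * sqrt h - 0 * 0) / h - 0) with (sqrt h) by (field; auto).
  rewrite Rabs_pos_eq by apply sqrt_pos.
  rewrite <- (sqrt_pow2 eps) by lra.
  apply Rle_lt_trans with (sqrt (Rabs h)).
  + apply sqrt_le_1_alt, Rle_abs.
  + apply sqrt_lt_1_alt. split; [apply Rabs_pos|]. simpl. lra.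
- auto_derive; [exact hx|].
  pose proof (sqrt_lt_R0 x hx). rewrite <- (sqrt_sqrt x) at 2 by lra. field. lra.
Qed.

Lemma is_derive_cubic_weight (s : R) :
  is_derive cubic_weight s (3 * (s * root_weight s)).
Proof.
evar_last.
- apply (is_derive_comp (fun x => x * sqrt x) (fun s => s ^ 2 - 1)).
  + apply is_derive_mult_sqrt.
  + instantiate (1 := 2 * s). auto_derive; [exact I|ring].
- unfold root_weight, scal; simpl; unfold mult; simpl. field.
Qed.

Lemma is_derive_id_mult_cubic_weight (s : R) :
  is_derive (fun s => s * cubic_weight s) s (4 * cubic_weight s + 3 * root_weight s).
Proof.
evar_last.
- apply (is_derive_mult (fun s => s) cubic_weight).
  + apply (is_derive_id s).
  + apply is_derive_cubic_weight.
  + intros; apply Rmult_comm.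
- unfold cubic_weight, plus, one, mult; simpl. ring.
Qed.

Lemma cubic_weight_pos (s : R) : 1 < s -> 0 < cubic_weight s.
Proof. intros hs. apply Rmult_lt_0_compat; [nra|now apply root_weight_pos]. Qed.

Lemma cubic_weight_nonneg (s : R) : 1 <= s -> 0 <= cubic_weight s.
Proof. intros hs. apply Rmult_le_pos; [nra|apply sqrt_pos]. Qed.

Lemma subexponential_cubic_weight : subexponential cubic_weight.
Proof.
apply subexponential_le with (fun s => s * (s * s)).
- intros s. apply (ex_derive_continuous cubic_weight).
  eexists. apply is_derive_cubic_weight.
- apply subexponential_mult_id, subexponential_mult_id, subexponential_id.
- intros s hs. pose proof (root_weight_bounds s hs).
  rewrite Rabs_pos_eq by now apply cubic_weight_nonneg.
  unfold cubic_weight. nra.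
Qed.

Lemma bessel_K1_laplace (z : R) : 0 < z -> bessel_K 1 z = z * laplace root_weight z.
Proof.
intros hz. unfold bessel_K.
rewrite (RInt_gen_laplace _ root_weight (z ^ 2) z subexponential_root_weight hz).
- simpl. field. lra.
- intros x hx. replace (INR 1 - 1 / 2) with (/ 2) by (simpl; lra).
  rewrite Rpower_sqrt by nra.
  unfold root_weight.
  replace (x ^ 2 - z ^ 2) with (z ^ 2 * ((x / z) ^ 2 - 1)) by (field; lra).
  assert (1 <= x / z) by (apply Rle_div_r; lra).
  rewrite sqrt_mult, sqrt_pow2 by nra. field. lra.
Qed.

Lemma bessel_K2_laplace (z : R) : 0 < z -> bessel_K 2 z = z ^ 2 / 3 * laplace cubic_weight z.
Proof.
intros hz. unfold bessel_K.
rewrite (RInt_gen_laplace _ cubic_weight (z ^ 4) z subexponential_cubic_weight hz).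
- simpl. field. lra.
- intros x hx. replace (INR 2 - 1 / 2) with (1 + / 2) by (simpl; lra).
  rewrite Rpower_plus, Rpower_1, Rpower_sqrt by nra.
  unfold cubic_weight, root_weight.
  replace (x ^ 2 - z ^ 2) with (z ^ 2 * ((x / z) ^ 2 - 1)) by (field; lra).
  assert (1 <= x / z) by (apply Rle_div_r; lra).
  rewrite sqrt_mult, sqrt_pow2 by nra. field. lra.
Qed.

(** Differentiating a transform multiplies its weight by [s]. This identity and the next integrate
    by parts to express the resulting moments through the two weights again, which closes the
    differential system for K_1 and K_2. *)
Lemma laplace_root_moment (z : R) : 0 < z ->
  z * laplace cubic_weight z = 3 * laplace (fun s => s * root_weight s) z.
Proof.
intros hz. rewrite <- (laplace_scal 3); auto.
2: apply subexponential_mult_id, subexponential_root_weight.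
apply laplace_by_parts; auto.
- apply is_derive_cubic_weight.
- apply subexponential_cubic_weight.
- apply (subexponential_scal 3 (fun s => s * root_weight s)), subexponential_mult_id,
    subexponential_root_weight.
- unfold cubic_weight. ring.
Qed.

Lemma laplace_cubic_moment (z : R) : 0 < z ->
  z * laplace (fun s => s * cubic_weight s) z
  = 4 * laplace cubic_weight z + 3 * laplace root_weight z.
Proof.
intros hz.
pose proof subexponential_root_weight as Hw.
pose proof subexponential_cubic_weight as Hq.
pose proof (subexponential_scal 4 _ Hq). pose proof (subexponential_scal 3 _ Hw).
rewrite <- (laplace_scal 4), <- (laplace_scal 3), <- laplace_plus by auto.
apply (laplace_by_parts (fun s => s * cubic_weight s)); auto.
- apply is_derive_id_mult_cubic_weight.
- now apply subexponential_mult_id.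
- now apply subexponential_plus.
- unfold cubic_weight. ring.
Qed.

Lemma bessel_K1_pos (z : R) : 0 < z -> 0 < bessel_K 1 z.
Proof.
intros hz. rewrite bessel_K1_laplace by auto. apply Rmult_lt_0_compat; auto.
apply laplace_pos; auto. apply subexponential_root_weight. apply root_weight_pos.
Qed.

Lemma bessel_K2_pos (z : R) : 0 < z -> 0 < bessel_K 2 z.
Proof.
intros hz. rewrite bessel_K2_laplace by auto. apply Rmult_lt_0_compat; [nra|].
apply laplace_pos; auto. apply subexponential_cubic_weight. apply cubic_weight_pos.
Qed.

Lemma locally_pos (z : R) : 0 < z -> locally z (fun y => 0 < y).
Proof. apply (open_gt 0). Qed.

Lemma is_derive_bessel_K1 (z : R) : 0 < z ->
  is_derive (bessel_K 1) z (bessel_K 1 z / z - bessel_K 2 z).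
Proof.
intros hz.
apply (is_derive_ext_loc (fun y => y * laplace root_weight y)).
{ apply filter_imp with (2 := locally_pos z hz). intros y hy.
  symmetry. now apply bessel_K1_laplace. }
evar_last.
- apply (is_derive_mult (fun y => y) (laplace root_weight)).
  + apply (is_derive_id z).
  + apply is_derive_laplace; auto.
    * apply subexponential_root_weight.
    * intros s hs. now apply root_weight_bounds.
  + intros; apply Rmult_comm.
- rewrite bessel_K1_laplace, bessel_K2_laplace by auto.
  pose proof (laplace_root_moment z hz). unfold plus, mult, one; simpl.
  replace (z * (z * 1) / 3 * laplace cubic_weight z)
    with (z / 3 * (z * laplace cubic_weight z)) by field.
  rewrite H. field. lra.
Qed.

Lemma is_derive_bessel_K2 (z : R) : 0 < z ->
  is_derive (bessel_K 2) z (- bessel_K 1 z - 2 * bessel_K 2 z / z).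
Proof.
intros hz.
apply (is_derive_ext_loc (fun y => y ^ 2 / 3 * laplace cubic_weight y)).
{ apply filter_imp with (2 := locally_pos z hz). intros y hy.
  symmetry. now apply bessel_K2_laplace. }
evar_last.
- apply (is_derive_mult (fun y => y ^ 2 / 3) (laplace cubic_weight)).
  + instantiate (1 := 2 * z / 3). auto_derive; [exact I|field].
  + apply is_derive_laplace; auto.
    * apply subexponential_cubic_weight.
    * apply cubic_weight_nonneg.
  + intros; apply Rmult_comm.
- rewrite bessel_K1_laplace, bessel_K2_laplace by auto.
  pose proof (laplace_cubic_moment z hz). unfold plus, mult; simpl.
  replace (z * (z * 1) / 3 * - laplace (fun s => s * cubic_weight s) z)
    with (- z / 3 * (z * laplace (fun s => s * cubic_weight s) z)) by field.
  rewrite H. field. lra.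
Qed.

(** With w the root weight, w <= s and w ^ 2 = s ^ 2 - 1 give s ^ 2 - 1 <= s w. The transform of s ^
    2 - 1 is 2 / z times that of s, hence at least 2 / z times that of w, and [laplace_root_moment]
    turns the transform of s w into K_2. *)
Lemma bessel_K1_le (z : R) : 0 < z -> bessel_K 1 z <= z / 2 * bessel_K 2 z.
Proof.
intros hz. rewrite bessel_K1_laplace, bessel_K2_laplace by auto.
pose proof (laplace_root_moment z hz) as H.
pose proof subexponential_root_weight as Hw.
pose proof subexponential_id as Hid.
assert (Hs : subexponential (fun s => s * s + -1)).
{ apply subexponential_plus; [now apply (subexponential_mult_id (fun s => s))|].
  apply subexponential_const. }
assert (H1 : laplace root_weight z <= laplace (fun s => s) z).
{ apply laplace_le; auto. intros s hs. now apply root_weight_bounds. }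
assert (H2 : z * laplace (fun s => s * s + -1) z = 2 * laplace (fun s => s) z).
{ rewrite <- (laplace_scal 2) by auto. apply laplace_by_parts; auto.
  - intros s. auto_derive; [exact I|ring].
  - now apply subexponential_scal.
  - ring. }
assert (H3 : laplace (fun s => s * s + -1) z <= laplace (fun s => s * root_weight s) z).
{ apply laplace_le; auto. now apply subexponential_mult_id.
  intros s hs. pose proof (root_weight_bounds s hs). pose proof (root_weight_sqr s hs). nra. }
replace (z / 2 * (z ^ 2 / 3 * laplace cubic_weight z))
  with (z * (z / 6 * (z * laplace cubic_weight z))) by field.
rewrite H. apply Rmult_le_compat_l; [lra|]. nra.
Qed.

(** * Asymptotics of the Bessel ratio *)

Lemma bessel_K2_decreasing (x y : R) : 0 < x <= y -> bessel_K 2 y <= bessel_K 2 x.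
Proof.
intros hxy.
destruct (MVT_gen (bessel_K 2) x y (fun z => - bessel_K 1 z - 2 * bessel_K 2 z / z)) as [c [Hc E]].
- intros z hz. rewrite Rmin_left in hz by lra. apply is_derive_bessel_K2. lra.
- intros z hz. rewrite Rmin_left in hz by lra.
  apply continuity_pt_filterlim. apply (ex_derive_continuous (bessel_K 2)).
  eexists. apply is_derive_bessel_K2. lra.
- rewrite Rmin_left in Hc by lra.
  pose proof (bessel_K1_pos c ltac:(lra)). pose proof (bessel_K2_pos c ltac:(lra)).
  assert (0 < 2 * bessel_K 2 c / c) by (apply Rdiv_lt_0_compat; lra). nra.
Qed.

Lemma nonpos_of_increasing_to_0 (f df : R -> R) (a C : R) :
  0 < a -> (forall x, a <= x -> is_derive f x (df x)) ->
  (forall x, a <= x -> 0 <= df x) -> (forall x, a <= x -> Rabs (f x) <= C / x) ->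
  forall x, a <= x -> f x <= 0.
Proof.
intros ha Hf Hdf HC x hx. apply Rnot_lt_le. intros hpos.
(* Beyond C / f x the bound C / y is smaller than f x, whereas monotonicity keeps f y at least f
   x. *)
set (y := Rmax x (C / f x + 1)).
assert (hy : x <= y) by apply Rmax_l.
assert (hy2 : C / f x + 1 <= y) by apply Rmax_r.
assert (Hm : 0 <= f y - f x).
{ apply (nonneg_of_derive_nonneg (fun y => f y - f x) df x); auto.
  - intros z hz. evar_last. apply (is_derive_minus f (fun _ => f x)).
    apply Hf; lra. apply (is_derive_const (f x)). unfold minus, plus, opp, zero; simpl. ring.
  - intros z hz. apply Hdf. lra.
  - ring. }
specialize (HC y ltac:(lra)). pose proof (Rle_abs (f y)).
assert (H1 : f x <= C / y) by lra.
apply (Rle_div_r (f x) C y) in H1; [|lra].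
assert (H2 : C / f x < y) by lra.
apply (Rlt_div_l C) in H2; lra.
Qed.

(* The expansion of [bessel_ratio] at infinity is
   [1 - 3 / (2 z) + 15 / (8 z ^ 2) - 15 / (8 z ^ 3) + ...]. *)
Definition ratio_approx (d z : R) : R := 1 - 3 / (2 * z) + 15 / (8 * z ^ 2) - d / z ^ 3.

(* The derivative of [ratio_primitive d] is [ratio_approx d z + 1 / z]. *)
Definition ratio_primitive (d z : R) : R :=
  z - ln z / 2 - 15 / (8 * z) + d / (2 * z ^ 2).

Definition ratio_defect (d z : R) : R :=
  (bessel_K 1 z - ratio_approx d z * bessel_K 2 z) * exp (- ratio_primitive d z).

(* The Riccati defect of [ratio_approx d], that is [R ^ 2 + 3 * R / z - 1 - R']. *)
Definition riccati_defect (d z : R) : R :=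
  (15 / 4 - 2 * d) / z ^ 3 + (225 / 64 - 3 * d) / z ^ 4 - 15 / 4 * d / z ^ 5 + d ^ 2 / z ^ 6.

(** Write R for [ratio_approx d] and w = K_1 - R K_2. The formulas for K_1' and K_2' give w' = (R +
    1 / z) w + (R ^ 2 + 3 R / z - 1 - R') K_2, and the exponential is the integrating factor that
    removes the first term. *)
Lemma is_derive_ratio_defect (d z : R) : 0 < z ->
  is_derive (ratio_defect d) z
    (riccati_defect d z * (bessel_K 2 z * exp (- ratio_primitive d z))).
Proof.
intros hz. unfold ratio_defect.
assert (Hz : z <> 0) by lra.
evar_last.
- apply (is_derive_mult (fun z => bessel_K 1 z - ratio_approx d z * bessel_K 2 z)
    (fun z => exp (- ratio_primitive d z))).
  + apply (is_derive_minus (bessel_K 1) (fun z => ratio_approx d z * bessel_K 2 z)).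
    * now apply is_derive_bessel_K1.
    * apply (is_derive_mult (ratio_approx d) (bessel_K 2)).
      -- instantiate (1 := 3 / (2 * z ^ 2) - 15 / (4 * z ^ 3) + 3 * d / z ^ 4).
         unfold ratio_approx. auto_derive.
         ++ repeat split; try apply Rmult_integral_contrapositive; try lra;
            try (split; [lra|]); nra.
         ++ field. auto.
      -- now apply is_derive_bessel_K2.
      -- intros; apply Rmult_comm.
  + instantiate (1 := - (ratio_approx d z + 1 / z) * exp (- ratio_primitive d z)).
    apply (is_derive_comp exp (fun z => - ratio_primitive d z)).
    * apply is_derive_exp.
    * unfold ratio_primitive, ratio_approx. auto_derive.
      -- repeat split; nra.
      -- field. auto.
  + intros; apply Rmult_comm.
- unfold minus, plus, opp, mult; simpl. unfold riccati_defect, ratio_approx. field. auto.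
Qed.

Lemma ratio_defect_bound (d : R) : 0 <= d <= 4 ->
  exists C, forall z, 1 <= z -> Rabs (ratio_defect d z) <= C / z.
Proof.
intros hd.
(* The constant is 10 times 16: |K_1 - R K_2| <= 10 K_2(1) z, the integrating factor is at most exp
   2 exp (- z / 2), and z exp (- z / 2) <= 16 / z. *)
exists (160 * bessel_K 2 1 * exp 2). intros z hz.
pose proof (bessel_K1_pos z ltac:(lra)) as P1.
pose proof (bessel_K2_pos z ltac:(lra)) as P2.
pose proof (bessel_K2_decreasing 1 z ltac:(lra)) as P3.
pose proof (bessel_K1_le z ltac:(lra)) as P4.
assert (hx : 0 < / z <= 1).
{ split; [apply Rinv_0_lt_compat; lra|]. rewrite <- Rinv_1. apply Rinv_le_contravar; lra. }
assert (hx2 : 0 < / z * / z <= 1) by nra.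
assert (hx3 : 0 < / z * / z * / z <= 1) by nra.
assert (HR : Rabs (ratio_approx d z) <= 9).
{ replace (ratio_approx d z)
    with (1 - 3 / 2 * / z + 15 / 8 * (/ z * / z) - d * (/ z * / z * / z))
    by (unfold ratio_approx; field; lra).
  apply Rabs_le_between; split; nra. }
apply Rabs_le_between in HR.
assert (HG : exp (- ratio_primitive d z) <= exp 2 * exp (- (z / 2))).
{ rewrite <- exp_plus.
  assert (Hle : - ratio_primitive d z <= 2 + - (z / 2)).
  { unfold ratio_primitive.
    assert (ln z <= z).
    { rewrite <- (ln_exp z) at 2. apply ln_le; [lra|]. pose proof (exp_ineq1_le z). lra. }
    replace (15 / (8 * z)) with (15 / 8 * / z) by (field; lra).
    replace (d / (2 * z ^ 2)) with (d / 2 * (/ z * / z)) by (field; lra).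
    nra. }
  destruct Hle as [Hle|Hle]; [left; now apply exp_increasing|right; now rewrite Hle]. }
assert (He : z * exp (- (z / 2)) <= 16 / z).
{ replace (- (z / 2)) with (- (z / 4) + - (z / 4)) by field. rewrite exp_plus, exp_Ropp.
  pose proof (exp_ineq1_le (z / 4)) as Hq.
  assert (/ exp (z / 4) <= / (z / 4)) by (apply Rinv_le_contravar; lra).
  assert (0 < / exp (z / 4)) by (apply Rinv_0_lt_compat; lra).
  replace (16 / z) with (z * (/ (z / 4) * / (z / 4))) by (field; lra).
  apply Rmult_le_compat_l; [lra|]. apply Rmult_le_compat; lra. }
unfold ratio_defect. rewrite Rabs_mult, (Rabs_pos_eq (exp _)) by (left; apply exp_pos).
assert (HW : Rabs (bessel_K 1 z - ratio_approx d z * bessel_K 2 z) <= 10 * bessel_K 2 1 * z).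
{ pose proof (bessel_K2_pos 1 ltac:(lra)).
  apply Rle_trans with (10 * bessel_K 2 z * z).
  - apply Rabs_le_between. split; nra.
  - apply Rmult_le_compat_r; lra. }
apply Rle_trans with (10 * bessel_K 2 1 * z * (exp 2 * exp (- (z / 2)))).
- apply Rmult_le_compat; auto; [apply Rabs_pos|left; apply exp_pos].
- replace (10 * bessel_K 2 1 * z * (exp 2 * exp (- (z / 2))))
    with (10 * bessel_K 2 1 * exp 2 * (z * exp (- (z / 2)))) by ring.
  replace (160 * bessel_K 2 1 * exp 2 / z) with (10 * bessel_K 2 1 * exp 2 * (16 / z)) by (field; lra).
  apply Rmult_le_compat_l; auto.
  pose proof (bessel_K2_pos 1 ltac:(lra)). pose proof (exp_pos 2). nra.
Qed.

(** The leading coefficient 15 / 4 - 2 d changes sign at d = 15 / 8, the coefficient in the true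
    expansion. The values 0 and 4 lie on either side of it, so the two defects have opposite signs
    for large z. *)
Lemma riccati_defect_0_nonneg (z : R) : 1 <= z -> 0 <= riccati_defect 0 z.
Proof.
intros hz. unfold riccati_defect.
replace ((15 / 4 - 2 * 0) / z ^ 3 + (225 / 64 - 3 * 0) / z ^ 4 - 15 / 4 * 0 / z ^ 5 + 0 ^ 2 / z ^ 6)
  with ((15 / 4 * z + 225 / 64) / z ^ 4) by (field; lra).
apply Rdiv_le_0_compat; [lra|]. apply pow_lt. lra.
Qed.

Lemma riccati_defect_4_nonpos (z : R) : 4 <= z -> 0 <= - riccati_defect 4 z.
Proof.
intros hz. unfold riccati_defect.
replace (- ((15 / 4 - 2 * 4) / z ^ 3 + (225 / 64 - 3 * 4) / z ^ 4 - 15 / 4 * 4 / z ^ 5 + 4 ^ 2 / z ^ 6))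
  with ((17 / 4 * z ^ 3 + (12 - 225 / 64) * z ^ 2 + 15 * z - 16) / z ^ 6) by (field; lra).
apply Rdiv_le_0_compat; [|apply pow_lt; lra].
pose proof (pow_lt z 3 ltac:(lra)). pose proof (pow_lt z 2 ltac:(lra)). lra.
Qed.

Lemma bessel_ratio_asymptotics (z : R) : 4 <= z ->
  ratio_approx 4 z <= bessel_ratio z <= ratio_approx 0 z.
Proof.
intros hz.
pose proof (bessel_K2_pos z ltac:(lra)) as P2.
destruct (ratio_defect_bound 0 ltac:(lra)) as [C0 H0].
destruct (ratio_defect_bound 4 ltac:(lra)) as [C4 H4].
assert (U : ratio_defect 0 z <= 0).
{ apply (nonpos_of_increasing_to_0 (ratio_defect 0) (fun z => riccati_defect 0 z *
    (bessel_K 2 z * exp (- ratio_primitive 0 z))) 4 C0); try lra.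
  - intros x hx. apply is_derive_ratio_defect. lra.
  - intros x hx. apply Rmult_le_pos; [apply riccati_defect_0_nonneg; lra|].
    apply Rmult_le_pos; left; [apply bessel_K2_pos; lra|apply exp_pos].
  - intros x hx. apply H0. lra. }
assert (L : - ratio_defect 4 z <= 0).
{ apply (nonpos_of_increasing_to_0 (fun z => - ratio_defect 4 z) (fun z => opp (riccati_defect 4 z *
    (bessel_K 2 z * exp (- ratio_primitive 4 z)))) 4 C4); try lra.
  - intros x hx. apply (is_derive_opp (ratio_defect 4)), is_derive_ratio_defect. lra.
  - intros x hx. unfold opp; simpl. rewrite <- Ropp_mult_distr_l_reverse.
    apply Rmult_le_pos; [apply riccati_defect_4_nonpos; lra|].
    apply Rmult_le_pos; left; [apply bessel_K2_pos; lra|apply exp_pos].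
  - intros x hx. rewrite Rabs_Ropp. apply H4. lra. }
unfold ratio_defect in U, L. unfold bessel_ratio.
pose proof (exp_pos (- ratio_primitive 0 z)). pose proof (exp_pos (- ratio_primitive 4 z)).
split.
- apply Rle_div_r; nra.
- apply Rle_div_l; nra.
Qed.

(** * Pressure and energy at constant entropy *)

(** This is t of the overview: rho / p = 3 + t, and exp t is the last factor of [n_of]. *)
Definition enthalpy_term (z : R) : R := z * bessel_ratio z.

(** At constant entropy, p and rho are the same constant multiple of this profile and of
    [energy_profile]; all dependence on z is in the profiles. *)
Definition pressure_profile (z : R) : R :=
  bessel_K 2 z / z ^ 2 * exp (enthalpy_term z).

Definition energy_profile (z : R) : R := pressure_profile z * (3 + enthalpy_term z).

(* [z p' / p] and [z rho' / p] at constant entropy. *)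
Definition pressure_slope (z : R) : R :=
  enthalpy_term z ^ 2 + 3 * enthalpy_term z - z ^ 2 - 4.

Definition energy_slope (z : R) : R :=
  pressure_slope z * (3 + enthalpy_term z) + (enthalpy_term z ^ 2 + 4 * enthalpy_term z - z ^ 2).

Lemma pressure_profile_pos (z : R) : 0 < z -> 0 < pressure_profile z.
Proof.
intros hz. apply Rmult_lt_0_compat; [|apply exp_pos].
apply Rdiv_lt_0_compat; [now apply bessel_K2_pos|nra].
Qed.

Lemma is_derive_bessel_ratio (z : R) : 0 < z ->
  is_derive bessel_ratio z (bessel_ratio z ^ 2 + 3 * bessel_ratio z / z - 1).
Proof.
intros hz. pose proof (bessel_K2_pos z hz). unfold bessel_ratio.
evar_last.
- apply is_derive_div; [now apply is_derive_bessel_K1|now apply is_derive_bessel_K2|lra].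
- field. lra.
Qed.

Lemma is_derive_enthalpy_term (z : R) : 0 < z ->
  is_derive enthalpy_term z
    ((enthalpy_term z ^ 2 + 4 * enthalpy_term z - z ^ 2) / z).
Proof.
intros hz. unfold enthalpy_term. evar_last.
- apply (is_derive_mult (fun z => z) bessel_ratio).
  + apply (is_derive_id z).
  + now apply is_derive_bessel_ratio.
  + intros; apply Rmult_comm.
- unfold plus, mult, one; simpl. field. lra.
Qed.

Lemma is_derive_pressure_profile (z : R) : 0 < z ->
  is_derive pressure_profile z (pressure_profile z * pressure_slope z / z).
Proof.
intros hz. unfold pressure_profile. pose proof (bessel_K2_pos z hz). evar_last.
- apply (is_derive_mult (fun z => bessel_K 2 z / z ^ 2) (fun z => exp (enthalpy_term z))).
  + apply (is_derive_div (bessel_K 2) (fun z => z ^ 2)).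
    * now apply is_derive_bessel_K2.
    * instantiate (1 := 2 * z). auto_derive; [exact I|ring].
    * nra.
  + apply (is_derive_comp exp enthalpy_term); [apply is_derive_exp|].
    now apply is_derive_enthalpy_term.
  + intros; apply Rmult_comm.
- unfold plus, mult, scal; simpl; unfold mult; simpl.
  assert (E : bessel_K 1 z = enthalpy_term z * bessel_K 2 z / z)
    by (unfold enthalpy_term, bessel_ratio; field; lra).
  rewrite E. unfold pressure_slope. field. lra.
Qed.

Lemma is_derive_energy_profile (z : R) : 0 < z ->
  is_derive energy_profile z (pressure_profile z * energy_slope z / z).
Proof.
intros hz. unfold energy_profile. evar_last.
- apply (is_derive_mult pressure_profile (fun z => 3 + enthalpy_term z)).
  + now apply is_derive_pressure_profile.
  + apply (is_derive_plus (fun _ => 3) enthalpy_term).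
    * apply (is_derive_const 3).
    * now apply is_derive_enthalpy_term.
  + intros; apply Rmult_comm.
- unfold energy_slope, plus, mult, zero; simpl. field. lra.
Qed.

Lemma enthalpy_term_small (z : R) : 0 < z -> 0 < enthalpy_term z <= z ^ 2 / 2.
Proof.
intros hz. pose proof (bessel_K1_pos z hz). pose proof (bessel_K2_pos z hz).
assert (0 < bessel_ratio z) by now apply Rdiv_lt_0_compat.
assert (bessel_ratio z <= z / 2) by (apply Rle_div_l; [lra|now apply bessel_K1_le]).
unfold enthalpy_term. split; nra.
Qed.

(** Only 0 < t <= z ^ 2 / 2 enters. With D and E the two slopes, D is near -4 and E near -12, while
    3 D - E = z ^ 2 + z ^ 2 t - 4 t ^ 2 - t ^ 3 is of order z ^ 2. The range exceeds 1 / 10 so that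
    an open interval can contain the regime. *)
Lemma slopes_small (z : R) : 0 < z <= 1 / 5 ->
  pressure_slope z < 0 /\ energy_slope z < 0 /\
  Rabs (pressure_slope z / energy_slope z - 1 / 3) <= z ^ 2.
Proof.
intros hz. pose proof (enthalpy_term_small z ltac:(lra)) as Ht.
unfold energy_slope, pressure_slope.
set (t := enthalpy_term z) in *. set (x := z ^ 2) in *.
assert (hx : 0 < x <= 1 / 25) by (unfold x; nra).
clearbody t x.
assert (HD : t ^ 2 + 3 * t - x - 4 <= - 39 / 10) by nra.
assert (HE : (t ^ 2 + 3 * t - x - 4) * (3 + t) + (t ^ 2 + 4 * t - x) <= - 11) by nra.
split; [lra|]. split; [lra|].
set (D := t ^ 2 + 3 * t - x - 4) in *.
set (E := D * (3 + t) + (t ^ 2 + 4 * t - x)) in *.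
replace (D / E - 1 / 3) with ((t ^ 3 + 4 * t ^ 2 - x * t - x) / (- 3 * E))
  by (unfold E, D in *; field; lra).
assert (t ^ 2 <= x / 50) by nra. assert (0 <= t ^ 3 <= x / 50) by nra.
assert (0 <= x * t <= x / 50) by nra.
apply Rabs_le_between. split.
- apply Rle_div_r; nra.
- apply Rle_div_l; nra.
Qed.

Lemma enthalpy_term_large (z : R) : 4 <= z ->
  15 / (8 * z) - 4 / z ^ 2 <= enthalpy_term z - z + 3 / 2 <= 15 / (8 * z).
Proof.
intros hz. destruct (bessel_ratio_asymptotics z hz) as [H1 H2].
unfold enthalpy_term, ratio_approx in *. split.
- apply Rmult_le_compat_l with (r := z) in H1; [|lra].
  replace (z * (1 - 3 / (2 * z) + 15 / (8 * z ^ 2) - 4 / z ^ 3))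
    with (z - 3 / 2 + 15 / (8 * z) - 4 / z ^ 2) in H1 by (field; lra). lra.
- apply Rmult_le_compat_l with (r := z) in H2; [|lra].
  replace (z * (1 - 3 / (2 * z) + 15 / (8 * z ^ 2) - 0 / z ^ 3))
    with (z - 3 / 2 + 15 / (8 * z)) in H2 by (field; lra). lra.
Qed.

(** Put t = z - 3 / 2 + u with u close to 15 / (8 z). The z ^ 2 terms cancel and D = - 25 / 4 + 2 z
    u + u ^ 2 is close to - 5 / 2. The energy slope factors as (D + 1) (t + 4), so the quotient is
    (z + 5 / 2 + u) (1 + 1 / D), with leading term 3 z / 5. *)
Lemma slopes_large (z : R) : 60 <= z ->
  pressure_slope z < 0 /\ energy_slope z < 0 /\
  Rabs (energy_slope z / pressure_slope z - 3 * z / 5) <= 41.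
Proof.
intros hz. pose proof (enthalpy_term_large z ltac:(lra)) as Ht.
unfold energy_slope.
assert (ED : pressure_slope z
  = - 25 / 4 + 2 * z * (enthalpy_term z - z + 3 / 2) + (enthalpy_term z - z + 3 / 2) ^ 2)
  by (unfold pressure_slope; field).
assert (EN : enthalpy_term z ^ 2 + 4 * enthalpy_term z - z ^ 2
  = pressure_slope z + 4 + enthalpy_term z) by (unfold pressure_slope; ring).
rewrite EN. set (t := enthalpy_term z) in *. set (D := pressure_slope z) in *.
set (u := t - z + 3 / 2) in *.
assert (Et : t = z - 3 / 2 + u) by (unfold u; ring).
clearbody t D u. clear EN. subst t.
assert (hy : 0 < / z <= / 60) by (split; [apply Rinv_0_lt_compat; lra|apply Rinv_le_contravar; lra]).
assert (hzy : z * / z = 1) by (field; lra).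
replace (15 / (8 * z)) with (15 / 8 * / z) in Ht by (field; lra).
replace (4 / z ^ 2) with (4 * (/ z * / z)) in Ht by (field; lra).
set (y := / z) in *. clearbody y.
assert (hu : 0 <= u <= 1 / 30) by nra.
assert (hv : 15 / 4 - 8 * y <= 2 * z * u <= 15 / 4).
{ pose proof (Rmult_le_compat_l (2 * z) _ _ ltac:(lra) (proj1 Ht)).
  pose proof (Rmult_le_compat_l (2 * z) _ _ ltac:(lra) (proj2 Ht)).
  assert (z * (y * y) = y) by (rewrite <- Rmult_assoc, hzy; ring).
  lra. }
assert (hu2 : 0 <= u ^ 2 <= y) by nra.
assert (hD : - 5 / 2 - 8 * y <= D <= - 5 / 2 + y) by lra.
clear ED hv.
assert (hD0 : D <= - 2) by lra.
set (q := / D).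
assert (hq : D * q = 1) by (unfold q; field; lra).
(* An error of order 1 / z in 1 / D is what is needed: multiplied by z it contributes at most 2 to
   the final bound. *)
assert (hq1 : - 2 / 5 - 2 * y <= q <= - 2 / 5 + 2 * y).
{ assert (hqn : q < 0) by (apply Rinv_lt_0_compat; lra).
  split; nra. }
assert (EQ : (D * (3 + (z - 3 / 2 + u)) + (D + 4 + (z - 3 / 2 + u))) / D
  = (z + 5 / 2 + u) * (1 + q)) by (unfold q; field; lra).
assert (HB : Rabs ((z + 5 / 2 + u) * (1 + q) - 3 * z / 5) <= 41).
{ replace ((z + 5 / 2 + u) * (1 + q) - 3 * z / 5)
    with (z * (q + 2 / 5) + (5 / 2 + u) * (1 + q)) by field.
  apply Rabs_le_between.
  assert (- 2 <= z * (q + 2 / 5) <= 2).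
  { pose proof (Rmult_le_compat_l z (- 2 * y) (q + 2 / 5) ltac:(lra) ltac:(lra)).
    pose proof (Rmult_le_compat_l z (q + 2 / 5) (2 * y) ltac:(lra) ltac:(lra)).
    lra. }
  split; nra. }
split; [lra|]. split; [|now rewrite EQ].
assert (0 < (z + 5 / 2 + u) * (1 + q)) by (apply Rmult_lt_0_compat; lra).
rewrite <- EQ in H.
set (S := D * (3 + (z - 3 / 2 + u)) + (D + 4 + (z - 3 / 2 + u))) in *.
replace S with (S / D * D) by (field; lra). nra.
Qed.

Lemma p_of_profile (m0 c kB h eta z : R) : z <> 0 ->
  p_of m0 c kB h eta z
  = m0 * c ^ 2 * (4 * PI * exp 1 ^ 4 * m0 ^ 3 * c ^ 3 * / h ^ 3) * exp (- eta / kB)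
    * pressure_profile z.
Proof.
intros hz. unfold p_of, n_of, pressure_profile, enthalpy_term, Rdiv.
replace (/ z ^ 2) with (/ z * / z) by (field; auto). ring.
Qed.

Lemma rho_of_profile (m0 c kB h eta z : R) : z <> 0 ->
  rho_of m0 c kB h eta z
  = m0 * c ^ 2 * (4 * PI * exp 1 ^ 4 * m0 ^ 3 * c ^ 3 * / h ^ 3) * exp (- eta / kB)
    * energy_profile z.
Proof.
intros hz. unfold energy_profile. rewrite <- Rmult_assoc, <- p_of_profile by auto.
unfold rho_of, p_of, enthalpy_term. field. auto.
Qed.

Lemma is_derive_scaled_profile (f g : R -> R) (C z l : R) :
  0 < z -> (forall y, y <> 0 -> f y = C * g y) -> is_derive g z l ->
  is_derive f z (C * l).
Proof.
intros hz Hfg Hg. apply (is_derive_ext_loc (fun y => C * g y)).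
- apply filter_imp with (2 := locally_pos z hz). intros y hy. symmetry. apply Hfg. lra.
- now apply (is_derive_scal g).
Qed.

Section Partials.
Variables (m0 c kB h : R).
Hypotheses (hm0 : 0 < m0) (hc : 0 < c) (hh : 0 < h).

Lemma scale_pos (x : R) : 0 < x ->
  0 < m0 * c ^ 2 * (4 * PI * exp 1 ^ 4 * m0 ^ 3 * c ^ 3 * / h ^ 3) * x.
Proof.
intros hx. pose proof PI_RGT_0.
pose proof (pow_lt _ 4 (exp_pos 1)). pose proof (pow_lt _ 3 hm0).
pose proof (pow_lt _ 3 hc). pose proof (pow_lt _ 2 hc).
pose proof (Rinv_0_lt_compat _ (pow_lt _ 3 hh)).
auto 10 using Rmult_lt_0_compat with real.
Qed.

Lemma partials_at_eta (eta z : R) : 0 < z ->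
  pressure_slope z < 0 -> energy_slope z < 0 ->
  ex_partial_at_eta (p_of m0 c kB h) (rho_of m0 c kB h) eta z /\
  partial_at_eta (p_of m0 c kB h) (rho_of m0 c kB h) eta z
    = pressure_slope z / energy_slope z /\
  ex_partial_at_eta (rho_of m0 c kB h) (p_of m0 c kB h) eta z /\
  partial_at_eta (rho_of m0 c kB h) (p_of m0 c kB h) eta z
    = energy_slope z / pressure_slope z.
Proof.
intros hz hp he.
pose proof (scale_pos (exp (- eta / kB)) (exp_pos _)) as hC.
set (C := m0 * c ^ 2 * (4 * PI * exp 1 ^ 4 * m0 ^ 3 * c ^ 3 * / h ^ 3) * exp (- eta / kB)) in hC.
pose proof (is_derive_scaled_profile _ _ C z _ hz
  (p_of_profile m0 c kB h eta) (is_derive_pressure_profile z hz)) as Dp.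
pose proof (is_derive_scaled_profile _ _ C z _ hz
  (rho_of_profile m0 c kB h eta) (is_derive_energy_profile z hz)) as Dr.
pose proof (pressure_profile_pos z hz) as hP.
assert (hCP : 0 < C * pressure_profile z / z).
{ apply Rdiv_lt_0_compat; auto. now apply Rmult_lt_0_compat. }
(* Both derivatives carry the same positive factor C P / z, with P the pressure profile; it cancels
   in the quotients. *)
replace (C * (pressure_profile z * pressure_slope z / z))
  with (C * pressure_profile z / z * pressure_slope z) in Dp by (field; lra).
replace (C * (pressure_profile z * energy_slope z / z))
  with (C * pressure_profile z / z * energy_slope z) in Dr by (field; lra).
unfold ex_partial_at_eta, partial_at_eta.
rewrite (is_derive_unique _ _ _ Dp), (is_derive_unique _ _ _ Dr).
repeat split; try (eexists; eassumption); try nra; field; repeat split; lra.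
Qed.
End Partials.

(** * Smooth inversion *)

Inductive bessel_expr (I : R -> Prop) : (R -> R) -> Prop :=
| bessel_expr_const c : bessel_expr I (fun _ => c)
| bessel_expr_id : bessel_expr I (fun z => z)
| bessel_expr_K1 : bessel_expr I (bessel_K 1)
| bessel_expr_K2 : bessel_expr I (bessel_K 2)
| bessel_expr_plus f g :
    bessel_expr I f -> bessel_expr I g -> bessel_expr I (fun z => f z + g z)
| bessel_expr_mult f g :
    bessel_expr I f -> bessel_expr I g -> bessel_expr I (fun z => f z * g z)
| bessel_expr_inv f :
    (forall z, I z -> f z <> 0) -> bessel_expr I f -> bessel_expr I (fun z => / f z)
| bessel_expr_exp f : bessel_expr I f -> bessel_expr I (fun z => exp (f z)).

Lemma bessel_expr_derive (I : R -> Prop) (f : R -> R) :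
  (forall z, I z -> 0 < z) -> bessel_expr I f ->
  exists df, bessel_expr I df /\ forall z, I z -> is_derive f z (df z).
Proof.
intros HI. induction 1 as [c | | | | f g Hf [df [Edf Df]] Hg [dg [Edg Dg]]
  | f g Hf [df [Edf Df]] Hg [dg [Edg Dg]] | f Hf0 Hf [df [Edf Df]] | f Hf [df [Edf Df]]].
- exists (fun _ => 0). split; [constructor|]. intros z _. apply (is_derive_const c).
- exists (fun _ => 1). split; [constructor|]. intros z _. apply (is_derive_id z).
- exists (fun z => bessel_K 1 z * / z + -1 * bessel_K 2 z). split.
  + repeat (constructor; auto). intros z hz. pose proof (HI z hz). lra.
  + intros z hz. evar_last; [now apply is_derive_bessel_K1, HI|]. unfold Rdiv. ring.
- exists (fun z => -1 * bessel_K 1 z + -2 * (bessel_K 2 z * / z)). split.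
  + repeat (constructor; auto). intros z hz. pose proof (HI z hz). lra.
  + intros z hz. evar_last; [now apply is_derive_bessel_K2, HI|]. unfold Rdiv. ring.
- exists (fun z => df z + dg z). split; [now constructor|].
  intros z hz. apply (is_derive_plus f g); auto.
- exists (fun z => df z * g z + f z * dg z). split; [now repeat constructor|].
  intros z hz. apply (is_derive_mult f g); auto. intros; apply Rmult_comm.
- exists (fun z => -1 * df z * (/ f z * / f z)). split; [now repeat constructor|].
  intros z hz. specialize (Hf0 z hz). evar_last; [apply (is_derive_inv f); auto|].
  field. auto.
- exists (fun z => df z * exp (f z)). split; [now repeat constructor|].
  intros z hz. apply (is_derive_comp exp f); auto. apply is_derive_exp.
Qed.

Section Inverse.
Variables (I : R -> Prop) (psi dpsi : R -> R).
Hypotheses (I_open : open I)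
  (I_conn : forall x y z, I x -> I y -> x <= z <= y -> I z)
  (psi_derive : forall z, I z -> is_derive psi z (dpsi z))
  (dpsi_neg : forall z, I z -> dpsi z < 0).

Lemma decreasing_of_derive_neg (x y : R) : I x -> I y -> x < y -> psi y < psi x.
Proof.
intros hx hy hxy.
assert (HI : forall z, Rmin x y <= z <= Rmax x y -> I z).
{ intros z hz. rewrite Rmin_left, Rmax_right in hz by lra. now apply (I_conn x y). }
destruct (MVT_gen psi x y dpsi) as [c [Hc E]].
- intros z hz. apply psi_derive, HI. lra.
- intros z hz. apply continuity_pt_filterlim, (ex_derive_continuous psi).
  eexists. now apply psi_derive, HI.
- specialize (dpsi_neg c (HI c Hc)). nra.
Qed.

Lemma injective_of_derive_neg (x y : R) : I x -> I y -> psi x = psi y -> x = y.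
Proof.
intros hx hy E. destruct (Rtotal_order x y) as [h|[h|h]]; auto.
- pose proof (decreasing_of_derive_neg x y hx hy h). lra.
- pose proof (decreasing_of_derive_neg y x hy hx h). lra.
Qed.

(** The intermediate value theorem on a small interval around x, whose endpoint values enclose
    [psi x] strictly. Existence of a preimage makes the image open; its closeness to x makes the
    inverse continuous. *)
Lemma image_neighborhood (x : R) (eps : posreal) : I x ->
  exists delta : posreal, forall t, Rabs (t - psi x) < delta ->
    exists z, I z /\ Rabs (z - x) < eps /\ psi z = t.
Proof.
intros hx. destruct (I_open x hx) as [e He].
set (r := Rmin e eps / 2).
pose proof (cond_pos e). pose proof (cond_pos eps).
assert (hr : 0 < r < e /\ r < eps).
{ unfold r. pose proof (Rmin_l e eps). pose proof (Rmin_r e eps).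
  pose proof (Rmin_pos e eps ltac:(auto) ltac:(auto)). lra. }
assert (HI : forall z, x - r <= z <= x + r -> I z).
{ intros z hz. apply He. apply Rabs_lt_between'. lra. }
pose proof (decreasing_of_derive_neg (x - r) x ltac:(apply HI; lra) hx ltac:(lra)).
pose proof (decreasing_of_derive_neg x (x + r) hx ltac:(apply HI; lra) ltac:(lra)).
assert (hd : 0 < Rmin (psi (x - r) - psi x) (psi x - psi (x + r))) by (apply Rmin_pos; lra).
exists (mkposreal _ hd). simpl. intros t ht.
pose proof (Rmin_l (psi (x - r) - psi x) (psi x - psi (x + r))).
pose proof (Rmin_r (psi (x - r) - psi x) (psi x - psi (x + r))).
apply Rabs_lt_between in ht.
destruct (Ranalysis5.IVT_interv (fun z => t - psi z) (x - r) (x + r)) as [z [hz E]]; try lra.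
- intros z hz. apply continuity_pt_filterlim, (ex_derive_continuous (fun z => t - psi z)).
  auto_derive. eexists. now apply psi_derive, HI.
- exists z. split; [now apply HI|]. split; [|lra]. apply Rabs_lt_between'. lra.
Qed.

(** Off the image of [I] the value is arbitrary; the function is evaluated only where a preimage in
    [I] exists or near such points, and the image is open. *)
Definition local_inverse (t : R) : R := epsilon (inhabits 0) (fun z => I z /\ psi z = t).

Lemma local_inverseK (z : R) : I z -> local_inverse (psi z) = z.
Proof.
intros hz. unfold local_inverse.
destruct (epsilon_spec (inhabits 0) (fun y => I y /\ psi y = psi z)) as [H1 H2].
- now exists z.
- now apply injective_of_derive_neg.
Qed.

Lemma is_derive_local_inverse (z : R) : I z ->
  is_derive local_inverse (psi z) (/ dpsi z).
Proof.
intros hz. apply is_derive_Reals. intros eps heps.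
pose proof (dpsi_neg z hz) as hd. set (d := dpsi z) in *.
(* If the quotient m of [psi] is within this of d < 0, the first bound gives m < d / 2, hence m d >
   d ^ 2 / 2, and the second then gives |1 / m - 1 / d| < eps. *)
assert (heta : 0 < Rmin (- d / 2) (eps * (d * d / 2))).
{ apply Rmin_pos; [lra|]. apply Rmult_lt_0_compat; [lra|nra]. }
pose proof (Rmin_l (- d / 2) (eps * (d * d / 2))) as h1.
pose proof (Rmin_r (- d / 2) (eps * (d * d / 2))) as h2.
pose proof (psi_derive z hz) as HD. apply is_derive_Reals in HD.
destruct (HD _ heta) as [e He].
destruct (image_neighborhood z e hz) as [delta Hdelta].
exists delta. intros s hs0 hs.
destruct (Hdelta (psi z + s)) as [y [hy [hyz Ey]]].
{ now replace (psi z + s - psi z) with s by ring. }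
rewrite <- Ey, !local_inverseK by auto.
assert (hyz0 : y - z <> 0).
{ intros E. replace y with z in Ey by lra. lra. }
specialize (He (y - z) hyz0 hyz).
replace (z + (y - z)) with y in He by ring. rewrite Ey in He.
replace (psi z + s - psi z) with s in He by ring.
set (m := s / (y - z)) in He. fold d in He.
assert (Em : (y - z) / s = / m) by (unfold m; field; auto).
rewrite Em. apply Rabs_lt_between in He.
assert (hm : m < d / 2) by lra.
replace (/ m - / d) with ((d - m) / (m * d)) by (field; lra).
assert (hmd : d * d / 2 < m * d) by nra.
apply Rabs_lt_between. split.
- apply Rlt_div_r; nra.
- apply Rlt_div_l; nra.
Qed.

(* [rho * exp (eta / k) / C] is the value of the profile [psi] at [z] when
   [rho = C * exp (- eta / k) * psi z]. *)
Variables (C k : R).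
Hypotheses (C_pos : 0 < C) (k_pos : 0 < k).

Definition reduced_energy (eta rho : R) : R := rho * exp (eta / k) / C.

Definition regime_image (er : R * R) : Prop :=
  exists z, I z /\ reduced_energy (fst er) (snd er) = psi z.

Lemma continuity_2d_exp_scal (a x y : R) :
  continuity_2d_pt (fun u _ => exp (a * u)) x y.
Proof.
apply (continuity_1d_2d_pt_comp (fun u => exp (a * u)) (fun u _ => u)).
- apply continuity_pt_filterlim, (ex_derive_continuous (fun u => exp (a * u))).
  auto_derive. exact Logic.I.
- apply continuity_2d_pt_id1.
Qed.

Lemma continuity_2d_reduced_energy (x y : R) : continuity_2d_pt reduced_energy x y.
Proof.
apply continuity_2d_pt_ext with (fun u v => v * exp (/ k * u) * / C).
- intros u v. unfold reduced_energy, Rdiv. now rewrite (Rmult_comm u).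
- apply continuity_2d_pt_mult; [|apply continuity_2d_pt_const].
  apply continuity_2d_pt_mult; [apply continuity_2d_pt_id2|apply continuity_2d_exp_scal].
Qed.

Lemma open_regime_image : open regime_image.
Proof.
intros [x y] [z [hz E]]. simpl in E.
destruct (image_neighborhood z (mkposreal 1 Rlt_0_1) hz) as [delta Hdelta].
apply (locally_2d_locally (fun u v => regime_image (u, v))).
generalize (continuity_2d_reduced_energy x y delta).
apply locally_2d_impl, locally_2d_forall. intros u v huv.
destruct (Hdelta (reduced_energy u v)) as [w [hw [_ Ew]]]; [now rewrite <- E|].
exists w. auto.
Qed.

(** A shape preserved by both partial derivatives: the one in eta keeps [a], the one in rho shifts
    it by 1 / k, and each replaces [Q] by an expression in [Q], its derivative and [psi], [dpsi].
    The pressure is the case a = - 1 / k. *)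
Definition entropy_function (a : R) (Q : R -> R) (eta rho : R) : R :=
  exp (a * eta) * Q (local_inverse (reduced_energy eta rho)).

Lemma is_derive_comp_local_inverse (Q : R -> R) (z l : R) :
  I z -> is_derive Q z l ->
  is_derive (fun t => Q (local_inverse t)) (psi z) (l * / dpsi z).
Proof.
intros hz HQ. rewrite Rmult_comm.
apply (is_derive_comp Q local_inverse).
- now rewrite local_inverseK.
- now apply is_derive_local_inverse.
Qed.

Lemma is_derive_entropy_function_l (a : R) (Q dQ : R -> R) (x y : R) :
  (forall z, I z -> is_derive Q z (dQ z)) -> regime_image (x, y) ->
  is_derive (fun u => entropy_function a Q u y) x
    (entropy_function a (fun z => a * Q z + dQ z * / dpsi z * psi z * / k) x y).
Proof.
intros HQ [z [hz E]]. simpl in E.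
unfold entropy_function. rewrite E, local_inverseK by auto.
evar_last.
- apply (is_derive_mult (fun u => exp (a * u))
    (fun u => Q (local_inverse (reduced_energy u y)))).
  + instantiate (1 := a * exp (a * x)). auto_derive; [exact Logic.I|ring].
  + apply (is_derive_comp (fun t => Q (local_inverse t)) (fun u => reduced_energy u y)).
    * rewrite E. now apply is_derive_comp_local_inverse, HQ.
    * instantiate (1 := reduced_energy x y * / k). unfold reduced_energy.
      auto_derive; [exact Logic.I|]. unfold Rdiv. ring.
  + intros; apply Rmult_comm.
- rewrite E, local_inverseK by auto.
  unfold plus, mult, scal; simpl; unfold mult; simpl. ring.
Qed.

Lemma is_derive_entropy_function_r (a : R) (Q dQ : R -> R) (x y : R) :
  (forall z, I z -> is_derive Q z (dQ z)) -> regime_image (x, y) ->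
  is_derive (fun v => entropy_function a Q x v) y
    (entropy_function (a + / k) (fun z => dQ z * / dpsi z * / C) x y).
Proof.
intros HQ [z [hz E]]. simpl in E.
unfold entropy_function. rewrite E, local_inverseK by auto.
evar_last.
- apply (is_derive_scal (fun v => Q (local_inverse (reduced_energy x v)))).
  apply (is_derive_comp (fun t => Q (local_inverse t)) (fun v => reduced_energy x v)).
  + rewrite E. now apply is_derive_comp_local_inverse, HQ.
  + instantiate (1 := exp (/ k * x) * / C). unfold reduced_energy.
    auto_derive; [exact Logic.I|]. unfold Rdiv. rewrite (Rmult_comm x). ring.
- unfold scal; simpl; unfold mult; simpl.
  replace ((a + / k) * x) with (a * x + / k * x) by ring. rewrite exp_plus. ring.
Qed.

Lemma continuity_2d_entropy_function (a : R) (Q dQ : R -> R) (x y : R) :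
  (forall z, I z -> is_derive Q z (dQ z)) -> regime_image (x, y) ->
  continuity_2d_pt (entropy_function a Q) x y.
Proof.
intros HQ [z [hz E]]. simpl in E.
apply continuity_2d_pt_mult; [apply continuity_2d_exp_scal|].
apply (continuity_1d_2d_pt_comp (fun t => Q (local_inverse t)) reduced_energy).
- apply continuity_pt_filterlim, (ex_derive_continuous (fun t => Q (local_inverse t))).
  rewrite E. eexists. now apply is_derive_comp_local_inverse, HQ.
- apply continuity_2d_reduced_energy.
Qed.

Hypotheses (I_pos : forall z, I z -> 0 < z)
  (psi_expr : bessel_expr I psi) (dpsi_expr : bessel_expr I dpsi).

(** Induction on the order with [a] and [Q] general, as the partial derivatives have the same shape
    with other parameters. Openness of the image lets the formulas for the partials hold near the
    point, which [ex_diff_n_ext_loc] requires. *)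
Lemma smooth_entropy_function (a : R) (Q : R -> R) :
  bessel_expr I Q -> smooth_on regime_image (entropy_function a Q).
Proof.
intros HQ n. revert a Q HQ.
assert (Hinv : bessel_expr I (fun z => / dpsi z)).
{ constructor; auto. intros z hz. specialize (dpsi_neg z hz). lra. }
induction n as [|n IH]; intros a Q HQ x y hxy;
  destruct (bessel_expr_derive I Q I_pos HQ) as [dQ [EdQ DQ]].
- split; [|exact Logic.I]. now apply (continuity_2d_entropy_function a Q dQ).
- split; [now apply (continuity_2d_entropy_function a Q dQ)|].
  assert (Hloc : locally_2d (fun u v => regime_image (u, v)) x y).
  { apply locally_2d_locally. now apply (open_regime_image (x, y)) in hxy as [e He];
      exists e; intros [u v]; apply He. }
  split; [|split; [|split]].
  + eexists. now apply (is_derive_entropy_function_l a Q dQ).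
  + eexists. now apply (is_derive_entropy_function_r a Q dQ).
  + apply ex_diff_n_ext_loc with
      (entropy_function a (fun z => a * Q z + dQ z * / dpsi z * psi z * / k)).
    * revert Hloc. apply locally_2d_impl, locally_2d_forall. intros u v huv.
      symmetry. now apply is_derive_unique, is_derive_entropy_function_l.
    * apply IH; auto. repeat (constructor; auto).
  + apply ex_diff_n_ext_loc with
      (entropy_function (a + / k) (fun z => dQ z * / dpsi z * / C)).
    * revert Hloc. apply locally_2d_impl, locally_2d_forall. intros u v huv.
      symmetry. now apply is_derive_unique, is_derive_entropy_function_r.
    * apply IH; auto. repeat (constructor; auto).
Qed.
End Inverse.

(** * The pressure as a smooth function of entropy and energy *)

Lemma bessel_expr_pressure_profile (I : R -> Prop) :
  (forall z, I z -> 0 < z) -> bessel_expr I pressure_profile.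
Proof.
intros HI.
(* [z * (z * 1)] and products with inverses are what [z ^ 2] and quotients unfold to, so this
   instance is convertible to the profile. *)
apply (bessel_expr_mult I (fun z => bessel_K 2 z * / (z * (z * 1)))
  (fun z => exp (z * (bessel_K 1 z * / bessel_K 2 z)))).
- repeat constructor. intros z hz. specialize (HI z hz). nra.
- repeat constructor. intros z hz. pose proof (bessel_K2_pos z (HI z hz)). lra.
Qed.

Lemma bessel_expr_energy_profile (I : R -> Prop) :
  (forall z, I z -> 0 < z) -> bessel_expr I energy_profile.
Proof.
intros HI.
apply (bessel_expr_mult I pressure_profile
  (fun z => 3 + z * (bessel_K 1 z * / bessel_K 2 z))).
- now apply bessel_expr_pressure_profile.
- repeat constructor. intros z hz. pose proof (bessel_K2_pos z (HI z hz)). lra.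
Qed.

(** On [I] the energy profile is strictly decreasing, so rho exp (eta / kB) / C, which equals that
    profile at z, determines z and with it p = C exp (- eta / kB) times the pressure profile. *)
Lemma p_smooth_function_of_energy_slope_neg (m0 c kB h : R) (I regime : R -> Prop) :
  0 < m0 -> 0 < c -> 0 < kB -> 0 < h ->
  open I -> (forall x y z, I x -> I y -> x <= z <= y -> I z) ->
  (forall z, I z -> 0 < z) -> (forall z, I z -> energy_slope z < 0) ->
  (forall z, 0 < z -> regime z -> I z) ->
  p_smooth_function_of_eta_rho m0 c kB h regime.
Proof.
intros hm0 hc hkB hh HO Hconn Hpos Hneg Hreg.
destruct (bessel_expr_derive I energy_profile Hpos (bessel_expr_energy_profile I Hpos))
  as [dpsi [Edpsi Dpsi]].
assert (dpsi_neg : forall z, I z -> dpsi z < 0).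
{ intros z hz. pose proof (Hpos z hz) as hz0.
  rewrite <- (is_derive_unique _ _ _ (Dpsi z hz)).
  rewrite (is_derive_unique _ _ _ (is_derive_energy_profile z hz0)).
  pose proof (pressure_profile_pos z hz0). specialize (Hneg z hz).
  pose proof (Rinv_0_lt_compat z hz0). unfold Rdiv.
  assert (0 < pressure_profile z * / z) by now apply Rmult_lt_0_compat. nra. }
pose proof (scale_pos m0 c h hm0 hc hh 1 Rlt_0_1) as hC. rewrite Rmult_1_r in hC.
set (C := m0 * c ^ 2 * (4 * PI * exp 1 ^ 4 * m0 ^ 3 * c ^ 3 * / h ^ 3)) in *.
exists (regime_image I energy_profile C kB).
exists (entropy_function I energy_profile C kB (- / kB) (fun z => C * pressure_profile z)).
split; [|split].
- eapply open_regime_image; eauto.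
- eapply smooth_entropy_function; eauto.
  + now apply bessel_expr_energy_profile.
  + constructor; [constructor|now apply bessel_expr_pressure_profile].
- intros n theta eta p rho [hn [ht [Ep [Er En]]]] Hz.
  set (z := z_of m0 c kB theta) in *.
  assert (hz : 0 < z).
  { apply Rdiv_lt_0_compat; apply Rmult_lt_0_compat; auto. now apply pow_lt. }
  specialize (Hreg z hz Hz).
  assert (Ep' : p = p_of m0 c kB h eta z).
  { unfold p_of. rewrite <- En, Ep. unfold z, z_of. field.
    repeat split; lra. }
  assert (Er' : rho = rho_of m0 c kB h eta z).
  { unfold rho_of. now rewrite <- En, <- Ep'. }
  rewrite p_of_profile in Ep' by lra. rewrite rho_of_profile in Er' by lra.
  fold C in Ep', Er'.
  assert (Et : reduced_energy C kB eta rho = energy_profile z).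
  { unfold reduced_energy. rewrite Er'.
    replace (C * exp (- eta / kB) * energy_profile z * exp (eta / kB) / C)
      with (exp (- eta / kB) * exp (eta / kB) * energy_profile z) by (field; lra).
    rewrite <- exp_plus.
    replace (- eta / kB + eta / kB) with 0 by (field; lra). rewrite exp_0. ring. }
  split.
  + exists z. auto.
  + unfold entropy_function. rewrite Et.
    rewrite (local_inverseK I energy_profile dpsi) by auto.
    rewrite Ep'. replace (- / kB * eta) with (- eta / kB) by (unfold Rdiv; ring). ring.
Qed.

Theorem lemma3p6 (m0 c kB h : R)
    (hm0 : 0 < m0) (hc : 0 < c) (hkB : 0 < kB) (hh : 0 < h) :
  p_smooth_function_of_eta_rho m0 c kB h (fun z => 0 < z <= 1 / 10) /\
  p_smooth_function_of_eta_rho m0 c kB h (fun z => 70 <= z) /\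
  (forall eta z : R, 0 < z <= 1 / 10 ->
    ex_partial_at_eta (p_of m0 c kB h) (rho_of m0 c kB h) eta z /\
    Rabs (partial_at_eta (p_of m0 c kB h) (rho_of m0 c kB h) eta z - 1 / 3)
      <= z ^ 2) /\
  (forall eta z : R, 70 <= z ->
    ex_partial_at_eta (rho_of m0 c kB h) (p_of m0 c kB h) eta z /\
    Rabs (partial_at_eta (rho_of m0 c kB h) (p_of m0 c kB h) eta z - 3 * z / 5)
      <= 41).
Proof.
split; [|split; [|split]].
(* The regime is enlarged to an open interval on which the energy slope is still negative; the other
   regime is treated likewise with z > 60. *)
- apply (p_smooth_function_of_energy_slope_neg m0 c kB h (fun z => 0 < z /\ z < 1 / 5)); auto.
  + apply open_and; [apply open_gt|apply open_lt].
  + intros x y z hx hy hz. lra.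
  + tauto.
  + intros z hz. apply slopes_small. lra.
  + intros z _ hz. lra.
- apply (p_smooth_function_of_energy_slope_neg m0 c kB h (fun z => 60 < z)); auto.
  + apply open_gt.
  + intros x y z hx hy hz. lra.
  + intros z hz. lra.
  + intros z hz. apply slopes_large. lra.
  + intros z _ hz. lra.
- intros eta z hz. destruct (slopes_small z ltac:(lra)) as [h1 [h2 h3]].
  destruct (partials_at_eta m0 c kB h hm0 hc hh eta z ltac:(lra) h1 h2) as [ex [E _]].
  now rewrite E.
- intros eta z hz. destruct (slopes_large z ltac:(lra)) as [h1 [h2 h3]].
  destruct (partials_at_eta m0 c kB h hm0 hc hh eta z ltac:(lra) h1 h2) as [_ [_ [ex E]]].
  now rewrite E.
Qed.
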